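(* Let $M$ be a von Neumann algebra with separable predual, and let $\mathcal S(M)$ be the space of von Neumann subalgebras of $M$ having the same unit as $M$, where each $N\in\mathcal S(M)$ is identified with its closed unit ball $(N)_1$. Then $\mathcal S(M)$ is a Polish space for the topology induced by the Vietoris topology on the space $\mathcal F((M)_1)$ of closed subsets of the unit ball $(M)_1$, where $(M)_1$ is endowed with the weak topology.
   Context: For a normed space $V$, $(V)_1$ denotes its closed unit ball. The weak topology on $(M)_1$ is the weak operator topology (for $M$ acting on a Hilbert space); on $(M)_1$ it coincides with the ultraweak (weak-$*$) topology $\sigma(M,M_* )$, and $(M)_1$ is compact Hausdorff for it. A von Neumann subalgebra of $M$ is an ultraweakly closed $*$-subalgebra; here it is required to contain the unit of $M$. For a compact Hausdorff space $X$, $\mathcal F(X)$ is the set of all closed subsets of $X$, and the Vietoris topology on $\mathcal F(X)$ is the topology generated by the sets $\{F\in\mathcal F(X): F\cap U\neq\emptyset\}$ and $\{F\in\mathcal F(X): F\subseteq U\}$, where $U$ ranges over the open subsets of $X$. The identification $N\mapsto (N)_1$ is an injection $\mathcal S(M)\to\mathcal F((M)_1)$, and $\mathcal S(M)$ carries the induced topology (the Maréchal topology). A Polish space is a separable topological space whose topology admits a compatible complete metric. *)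

(* Defs.v *)
From HB Require Import structures.
From mathcomp Require Import all_boot all_order all_algebra.
From mathcomp Require Import complex ring.
From mathcomp Require Import all_classical all_reals all_analysis.

Set Implicit Arguments.
Unset Strict Implicit.
Unset Printing Implicit Defensive.

Import Order.TTheory GRing.Theory Num.Theory.
Import numFieldNormedType.Exports.

Local Open Scope classical_set_scope.
Local Open Scope ring_scope.

(* A Hermitian form is linear in its first argument. *)
HB.mixin Record CompleteNormedModule_isHilbert (R : realType) H
    & CompleteNormedModule R[i] H := {
  inner : {dot H for @Num.conj R[i]};
  inner_norm : forall x : H, inner x x = `|x| ^+ 2
}.

#[short(type="hilbertType")]
HB.structure Definition Hilbert (R : realType) :=
  {H of CompleteNormedModule R[i] H & CompleteNormedModule_isHilbert R H}.

Section Vietoris.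
Context (X : topologicalType).

Definition closed_subsets := set_type [set F : set X | closed F].

HB.instance Definition _ := Choice.on closed_subsets.

Definition vietoris_subbase : set (set closed_subsets) :=
  [set [set F | set_val F `&` U !=set0] | U in @open X] `|`
  [set [set F | set_val F `<=` U] | U in @open X].

HB.instance Definition _ := isSubBaseTopological.Build closed_subsets
  vietoris_subbase id.

End Vietoris.

Definition separable (T : topologicalType) :=
  exists2 D : set T, countable D & dense D.

Definition completely_metrizable (R : realType) (T : topologicalType) :=
  exists d : T -> T -> R,
    [/\ (forall x y, d x y = 0 <-> x = y),
        (forall x y, d x y = d y x),
        (forall x y z, d x z <= d x y + d y z),
        (forall x (A : set T), nbhs x A <->
           exists2 e : R, 0 < e & [set y | d x y < e] `<=` A) &
        (forall u : nat -> T,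
           (forall e : R, 0 < e -> exists N, forall m n,
              (N <= m)%N -> (N <= n)%N -> d (u m) (u n) < e) ->
           exists l : T, u @ \oo --> l)].

Definition polish (R : realType) (T : topologicalType) :=
  separable T /\ completely_metrizable R T.

Lemma ptws_cvgP (I : Type) (T : topologicalType) (F : set_system (I -> T))
    {FF : Filter F} (f : I -> T) :
  {ptws, F --> f} <-> forall i, (fun g => g i) @ F --> f i.
Proof.
split=> [Ff i A|Ff].
  rewrite nbhsE => -[W [oW Wf] WA]; apply: (filterS (fun g => WA (g i))).
  move/cvg_sup : Ff => /(_ i); apply.
  by exists ((fun g : I -> T => g i) @^-1` W); split => //=; exists W.
apply/cvg_sup => i A [_ /= [[W oW <-]] Wf WA].
by apply: (filterS WA); apply: Ff; exact: open_nbhs_nbhs.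
Qed.

Section BoundedOperators.
Context {R : realType} (H : hilbertType R).

Definition bounded_operator : {pred H -> H} :=
  [pred f : H -> H | `[< linear f /\ continuous f >]].

Record bop := Bop { bop_fun :> H -> H; bopP : bop_fun \in bounded_operator }.

HB.instance Definition _ := [isSub for bop_fun].
HB.instance Definition _ := [Choice of bop by <:].

Lemma bounded_operator_submod : submod_closed bounded_operator.
Proof.
split=> [|a f g].
  apply/asboolP; split=> [b x y|]; first by rewrite /= scaler0 addr0.
  exact: cst_continuous.
move=> /asboolP[lf cf] /asboolP[lg cg]; apply/asboolP; split=> [b x y|x].
  rewrite !fctE lf lg !scalerDr !scalerA [a * b]mulrC !addrA.
  by congr (_ + _); rewrite -!addrA; congr (_ + _); rewrite addrC.
by apply: cvgD; [apply: cvgZl_tmp; exact: cf|exact: cg].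
Qed.

HB.instance Definition _ :=
  GRing.isSubmodClosed.Build R[i] (H -> H) bounded_operator
    bounded_operator_submod.
HB.instance Definition _ := [SubChoice_isSubLmodule of bop by <:].

Lemma bop_linear (T : bop) : linear T.
Proof. by case: T => f /= /asboolP[]. Qed.

Lemma bop_continuous (T : bop) : continuous T.
Proof. by case: T => f /= /asboolP[]. Qed.

HB.instance Definition _ (T : bop) :=
  GRing.isLinear.Build R[i] H H *:%R T (bop_linear T).

Lemma bounded_operator_id : (@id H) \in bounded_operator.
Proof. by apply/asboolP; split=> // x; exact: cvg_id. Qed.

Lemma bounded_operator_comp (S T : bop) : S \o T \in bounded_operator.
Proof.
apply/asboolP; split=> [a x y|x]; first by rewrite /= !linearP.
by apply: continuous_comp; exact: bop_continuous.
Qed.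

Definition bop_id := Bop bounded_operator_id.
Definition bop_comp (S T : bop) := Bop (bounded_operator_comp S T).

Lemma bop_compA : associative bop_comp.
Proof. by move=> S T U; apply/val_inj. Qed.

Lemma bop_comp1l : left_id bop_id bop_comp.
Proof. by move=> T; apply/val_inj. Qed.

Lemma bop_comp1r : right_id bop_id bop_comp.
Proof. by move=> T; apply/val_inj. Qed.

Lemma bop_compDl : left_distributive bop_comp +%R.
Proof. by move=> S T U; apply/val_inj. Qed.

Lemma bop_compDr : right_distributive bop_comp +%R.
Proof.
by move=> S T U; apply/val_inj/funext => x /=; rewrite linearD.
Qed.

HB.instance Definition _ := GRing.Zmodule_isPzRing.Build bop
  bop_compA bop_comp1l bop_comp1r bop_compDl bop_compDr.

Definition opnorm (T : bop) : R :=
  sup [set complex.Re `|T x| | x in [set x | `|x| <= 1]].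

Definition unit_ball (M : set bop) : set bop := [set T | M T /\ opnorm T <= 1].

Definition is_adjoint (T S : bop) := forall x y, inner (T x) y = inner x (S y).

(* [wot] and [ultraweak] are copies of [bop] carrying the coarsest topology for
   which the maps [wot_form^~ p], resp. [ultraweak_form^~ p], are continuous
   ([R[i]] is a topological space under the name [R[i]^o]). *)
Definition wot_form (T : bop) (p : H * H) : R[i]^o := inner (T p.1) p.2.

Definition wot := initial_topology (wot_form : bop -> {ptws H * H -> R[i]^o}).

HB.instance Definition _ := Topological.on wot.

Definition l2seq :=
  {x : nat -> H | cvgn (series (fun n => `|x n| ^+ 2 : R[i]^o))}.

(* [T |-> \sum_n <T x_n, y_n>], a convergent series as [\sum_n |x_n|^2] and
   [\sum_n |y_n|^2] are finite. *)
Definition ultraweak_form (T : bop) (p : l2seq * l2seq) : R[i]^o :=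
  limn (series (fun n => inner (T (sval p.1 n)) (sval p.2 n) : R[i]^o)).

Definition ultraweak :=
  initial_topology (ultraweak_form : bop -> {ptws l2seq * l2seq -> R[i]^o}).

HB.instance Definition _ := Topological.on ultraweak.

(* As the unit of [N] is the identity operator of [H], all von Neumann algebras
   on [H] have the same unit. An operator has at most one adjoint. *)
Record von_neumann (N : set bop) : Prop := VonNeumann {
  von_neumann1 : N 1;
  von_neumann_linear : forall a S T, N S -> N T -> N (a *: S + T);
  von_neumannM : forall S T, N S -> N T -> N (S * T);
  von_neumann_adjoint : forall T, N T -> exists2 S, N S & is_adjoint T S;
  von_neumann_closed : closed (N : set ultraweak)
}.

(* The ultraweakly continuous linear functionals on [M], each one represented by
   any of its extensions to a function on [bop]: the values outside [M] do not
   matter for [predual], [dual_norm] and [separable_predual]. *)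
Definition predual (M : set bop) : set (bop -> R[i]) :=
  [set phi | (forall a S T, M S -> M T ->
                phi (a *: S + T) = a * phi S + phi T) /\
             {within (M : set ultraweak),
                continuous (phi : ultraweak -> R[i]^o)}].

Definition dual_norm (M : set bop) (phi : bop -> R[i]) : R :=
  sup [set complex.Re `|phi T| | T in unit_ball M].

Definition separable_predual (M : set bop) :=
  exists D : set (bop -> R[i]), [/\ countable D, D `<=` predual M &
    forall phi, predual M phi -> forall e, 0 < e ->
      exists2 psi, D psi & dual_norm M (fun T => phi T - psi T) < e].

Definition weak_ball (M : set bop) := set_type (unit_ball M : set wot).

HB.instance Definition _ M := Topological.on (weak_ball M).

Lemma complex_cauchy_cvg (u : nat -> R[i]^o) :
  (forall e : R, 0 < e -> exists N, forall m n, (N <= m)%N -> (N <= n)%N ->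
     complex.Re `|u m - u n| <= e) -> cvgn u.
Proof.
move=> uC.
have part (f : R[i] -> R) : (forall x y, f (x - y) = f x - f y) ->
    (forall z, `|f z| <= complex.Re `|z|) -> cvgn (f \o u).
  move=> fB fle; apply/cauchy_cvgP/cauchy_exP => e e0.
  have [N NP] := uC _ (divr_gt0 e0 (ltr0n _ 2)).
  exists (f (u N)); exists N => //= n /= Nn.
  rewrite -ball_normE /= -fB (le_lt_trans (fle _))//.
  by rewrite (le_lt_trans (NP N n _ _))// ltr_pdivrMr// ltr_pMr// ltr1n.
have /cvg_ex[a ua] : cvgn (@complex.Re R \o u).
  apply: part; first by move=> [? ?] [? ?].
  by move=> [x y] /=; rewrite -sqrtr_sqr ler_wsqrtr// lerDl sqr_ge0.
have /cvg_ex[b ub] : cvgn (@complex.Im R \o u).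
  apply: part; first by move=> [? ?] [? ?].
  by move=> [x y] /=; rewrite -sqrtr_sqr ler_wsqrtr// lerDr sqr_ge0.
apply/cvg_ex; exists (a +i* b)%C; apply/cvgrPdist_le => e.
rewrite ltcE /= => /andP[/eqP e0 Re0].
move/cvgrPdist_le : ua => /(_ _ (divr_gt0 Re0 (ltr0n _ 2))) ua.
move/cvgrPdist_le : ub => /(_ _ (divr_gt0 Re0 (ltr0n _ 2))) ub.
near=> n.
have xa : `|a - complex.Re (u n)| <= complex.Re e / 2 by near: n.
have yb : `|b - complex.Im (u n)| <= complex.Re e / 2 by near: n.
have -> : e = ((complex.Re e / 2)%:C + (complex.Re e / 2)%:C)%C.
  by rewrite -rmorphD -splitr; case: (e) e0 => x y /= ->.
have -> : (a +i* b)%C - u n =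
    ((a - complex.Re (u n))%:C + 'i * (b - complex.Im (u n))%:C)%C.
  by case: (u n) => x y; rewrite [RHS]/= ; simpc.
rewrite (le_trans (ler_normD _ _))// lerD//.
  by rewrite normc_def /= expr0n /= addr0 sqrtr_sqr lecR xa.
rewrite normrM normc_def /= expr0n expr1n /= add0r sqrtr1 mul1r.
by rewrite normc_def /= expr0n /= addr0 sqrtr_sqr lecR yb.
Unshelve. all: by end_near. Qed.

Lemma opnorm_le1 (T : bop) x : opnorm T <= 1 -> `|T x| <= `|x|.
Proof.
move=> T1; have [->|x0] := eqVneq x 0; first by rewrite linear0.
have /linear_bounded_continuous/linear_boundedP/pinfty_ex_gt0[r r0 Tr] := @bop_continuous T.
have Rnn (z : R[i]) : 0 <= z -> z = (complex.Re z)%:C%C.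
  by move=> z0; rewrite [LHS]complexE ger0_Im// mulr0 addr0.
have nx : 0 < `|x| by rewrite normr_gt0.
have : complex.Re `|T (`|x|^-1 *: x)| <= 1.
  apply: le_trans T1; apply: ub_le_sup.
    exists (complex.Re r) => _ [y /= y1 <-].
    have : `|T y| <= r by rewrite (le_trans (Tr y))// ler_piMr// ltW.
    by rewrite lecE => /andP[].
  exists (`|x|^-1 *: x) => //=.
  by rewrite normrZ ger0_norm ?invr_ge0// mulVf ?gt_eqF.
rewrite -lecR -Rnn// linearZ /= normrZ ger0_norm ?invr_ge0//.
by rewrite ler_pdivrMl// mulr1.
Qed.

Lemma inner_le (x y : H) : `|inner x y| <= `|x| ^+ 2 + `|y| ^+ 2 :> R[i].
Proof.
have [->|d0] := eqVneq (inner x y) 0; first by rewrite normr0 addr_ge0 ?exprn_ge0.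
set d := inner x y in d0 *; pose c := d / `|d|.
have nd0 : `|d| != 0 by rewrite normr_eq0.
have nc : `|c| = 1 by rewrite normrM normfV normr_id mulfV.
have xc : inner x (c *: y) = `|d|.
  rewrite linearZr_LR /= -/d /c rmorphM fmorphV /= (conj_Creal (normr_real _)).
  by rewrite mulrAC [_ * d]mulrC -normCK expr2 mulfK.
have := dnorm_ge0 inner (x - c *: y).
rewrite dnormB xc dnormZ nc expr1n mul1r (conj_Creal (normr_real _)) !inner_norm.
by rewrite subr_ge0; apply: le_trans; rewrite lerDl.
Qed.

Lemma ultraweak_tail (p : l2seq * l2seq) (e : R[i]) : 0 < e ->
  exists N, forall T : bop, opnorm T <= 1 -> forall n, (N <= n)%N ->
    `|ultraweak_form T p -
      series (fun n => inner (T (sval p.1 n)) (sval p.2 n) : R[i]^o) n| <= e.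
Proof.
case: p => -[x cx] [y cy] e0 /=.
pose s (T : bop) := series (fun n => inner (T (x n)) (y n) : R[i]^o).
have tail (d : R[i]) : 0 < d -> exists N, forall T, opnorm T <= 1 ->
    forall m n, (N <= m)%N -> (N <= n)%N -> `|s T m - s T n| <= d.
  move=> d0; have d20 : 0 < d / 2 by rewrite divr_gt0.
  move: cx => /cvg_cauchy/cauchy_seriesP/(_ _ d20).
  move=> [[A B] /= [[N1 _ A1] [N2 _ B1]] AB].
  move: cy => /cvg_cauchy/cauchy_seriesP/(_ _ d20).
  move=> [[A' B'] /= [[N3 _ A3] [N4 _ B3]] AB'].
  exists (maxn (maxn N1 N2) (maxn N3 N4)) => T T1 m n.
  wlog mn : m n / (n <= m)%N => [W Nm Nn|].
    have [mn|/ltnW mn] := leqP n m; first exact: W.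
    by rewrite distrC W.
  rewrite !geq_max => /andP[/andP[m1 m2] /andP[m3 m4]].
  move=> /andP[/andP[n1 n2] /andP[n3 n4]].
  rewrite /s sub_series_geq// (le_trans (ler_norm_sum _ _ _))//.
  rewrite (@le_trans _ _ (\sum_(n <= k < m) (`|x k| ^+ 2 + `|y k| ^+ 2)))//.
    apply: ler_sum => k _; rewrite (le_trans (inner_le _ _))// lerD2r.
    by rewrite ler_sqr ?nnegrE// opnorm_le1.
  rewrite big_split /= (splitr d) lerD//.
    have /ltW := AB (n, m) (conj (A1 _ n1) (B1 _ m2)).
    by apply: le_trans; rewrite /= ger0_norm// sumr_ge0// => k _; rewrite exprn_ge0.
  have /ltW := AB' (n, m) (conj (A3 _ n3) (B3 _ m4)).
  by apply: le_trans; rewrite /= ger0_norm// sumr_ge0// => k _; rewrite exprn_ge0.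
have cvg_s T : opnorm T <= 1 -> cvgn (s T).
  move=> T1; apply: complex_cauchy_cvg => d d0.
  have [|N NP] := tail d%:C%C; first by rewrite ltcR.
  exists N => m n Nm Nn; have := NP T T1 m n Nm Nn.
  by rewrite lecE => /andP[].
have [N NP] := tail _ (divr_gt0 e0 (ltr0n _ 2)).
exists N => T T1 n Nn; rewrite /ultraweak_form /= -/(s T).
have /cvgrPdist_le/(_ _ (divr_gt0 e0 (ltr0n _ 2)))[K _ KP] := cvg_s T T1.
have := KP (maxn K N) (leq_maxl _ _) => /= h.
rewrite -(subrK (s T (maxn K N)) (limn _)) -addrA (le_trans (ler_normD _ _))//.
by rewrite (splitr e) lerD// NP// leq_maxr.
Qed.

Lemma wot_form_continuous (p : H * H) :
  continuous (fun T : wot => wot_form T p : R[i]^o).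
Proof.
move=> T.
have c : {ptws, wot_form x @[x --> T] --> wot_form T}.
  exact: (@initial_continuous bop {ptws H * H -> R[i]^o} wot_form T).
exact: (proj1 (@ptws_cvgP _ _ _ (fmap_filter _ (nbhs_filter (T : wot))) _) c p).
Qed.

Lemma wot_series_continuous (x y : nat -> H) n :
  continuous (fun T : wot =>
    series (fun k => inner ((T : bop) (x k)) (y k) : R[i]^o) n).
Proof.
move=> T; elim: n => [|n IHn].
  rewrite (_ : (fun _ => _) = fun=> 0).
    exact: (@cvg_cst _ _ _ _ (nbhs_filter T)).
  by apply/funext => S; rewrite /series /= big_nil.
rewrite (_ : (fun _ => _) = (fun T : wot =>
    series (fun k => inner ((T : bop) (x k)) (y k) : R[i]^o) n) +
    (fun T : wot => wot_form T (x n, y n))).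
  apply: (@cvgD _ _ _ _ (nbhs_filter T)); first exact: IHn.
  exact: wot_form_continuous.
by apply/funext => S; rewrite /series /= big_nat_recr.
Qed.

Lemma ultraweak_continuous (M : set bop) :
  continuous (set_val : weak_ball M -> ultraweak).
Proof.
apply: continuous_comp_initial => t.
apply/(@ptws_cvgP _ _ _ (fmap_filter _ (nbhs_filter t))) => p.
suff : ultraweak_form (set_val u) p @[u --> t] --> ultraweak_form (set_val t) p
  by [].
apply/(@cvgrPdist_le _ _ _ _ (nbhs_filter t)) => e e0.
have e30 : 0 < e / 3 by rewrite divr_gt0.
have [N NP] := ultraweak_tail p e30.
pose s (T : bop) := series (fun n => inner (T (sval p.1 n)) (sval p.2 n) : R[i]^o) N.
have cs : continuous (s \o set_val : weak_ball M -> R[i]^o).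
  move=> u; apply: (@continuous_comp _ wot _ set_val s).
    exact: initial_continuous.
  exact: wot_series_continuous.
have t1 (u : weak_ball M) : opnorm (set_val u) <= 1.
  by have [_] := set_valP u.
have /(@cvgrPdist_le _ _ _ _ (nbhs_filter t))/(_ _ e30) := cs t.
apply: filterS => u /= tu.
have := NP _ (t1 t) _ (leqnn _); have := NP _ (t1 u) _ (leqnn _).
rewrite -!/(s _) => hu ht; rewrite distrC in hu.
have -> : ultraweak_form (set_val t) p - ultraweak_form (set_val u) p =
    (ultraweak_form (set_val t) p - s (set_val t)) +
    (s (set_val t) - s (set_val u)) +
    (s (set_val u) - ultraweak_form (set_val u) p).
  by rewrite !subrKA.
have -> : e = e / 3 + e / 3 + e / 3 by field.
by rewrite (le_trans (ler_normD _ _))// lerD// (le_trans (ler_normD _ _))// lerD.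
Qed.

Definition ball_in (M N : set bop) : set (weak_ball M) :=
  [set T | unit_ball N (set_val T)].

Lemma closed_ball_in (M N : set bop) : von_neumann N -> closed (@ball_in M N).
Proof.
move=> /von_neumann_closed cN.
rewrite (_ : @ball_in M N = (set_val : weak_ball M -> ultraweak) @^-1` N).
  by apply: closed_comp cN => T _; exact: ultraweak_continuous.
apply/seteqP; split=> T; first by case.
by move=> NT; split=> //; have [_] := set_valP T.
Qed.

Definition subalgebras (M : set bop) :=
  set_type [set N : set bop | von_neumann N /\ N `<=` M].

HB.instance Definition _ M := Choice.on (subalgebras M).

Definition subalgebra_ball (M : set bop) (N : subalgebras M) :
    closed_subsets (weak_ball M) :=
  exist _ (@ball_in M (set_val N)) (mem_set (@closed_ball_in M _ (set_valP N).1)).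

Definition marechal (M : set bop) := initial_topology (@subalgebra_ball M).

HB.instance Definition _ M := Topological.on (marechal M).

End BoundedOperators.

(* Main.v *)
From HB Require Import structures.
Require Import Defs.
From mathcomp Require Import finmap all_boot all_order all_algebra.
From mathcomp Require Import complex ring lra.
From mathcomp Require Import all_classical all_reals all_analysis borel_hierarchy.

Set Implicit Arguments.
Unset Strict Implicit.
Unset Printing Implicit Defensive.

Import Order.TTheory GRing.Theory Num.Theory.
Import numFieldNormedType.Exports.

Local Open Scope classical_set_scope.
Local Open Scope ring_scope.

(** Write X for the unit ball of M with the weak topology.  It is compact
    ([weak_ball_compact], Banach-Alaoglu), and a countable norm-dense set of
    normal functionals provides countably many continuous real functions that
    separate its points ([real_coordinates]).  Finite boxes in these functions
    are a countable base of X made of cozero sets ([bump_cozero_base]).  The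
    suprema over a closed set F of the functions defining that base determine F
    and its Vietoris neighbourhoods, and they embed the closed subsets of X as
    a closed subspace of a countable power of the real line
    ([height_coordinates]).  Hence that hyperspace is Polish, and by
    Alexandrov's theorem ([Gdelta_polish]) it is enough to show that the unit
    balls of von Neumann subalgebras form a G_delta among the closed sets.

    A closed set F is such a ball exactly when it is nonempty and is stable
    under the unit, midpoints, scalars of modulus at most 1, products, adjoints
    and those doublings s |-> 2s that stay in X ([range_subalgebra_ball]).
    Each of these conditions is a G_delta ([Gdelta_stable]).  Failure of
    stability under an operation m is witnessed by a basic open set U that
    misses F and a pair (s, t) of points of F with m(s, t) in U.  The product
    is not jointly continuous, so m(s, t) in U is not an open condition on
    (s, t); but separate continuity makes it a countable union of closed
    rectangles A x B ([sigma_rectangular_op]), and the sets F that meet both A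
    and B and miss U form a closed set.

    The delicate half of the characterization is that, for a stable F, the
    union N of its dilates 2^n F is ultraweakly closed.  This is a form of
    Kaplansky's density theorem ([adherent_mem]).  If A is self-adjoint and in
    the weak closure of N, then A is a strong limit of self-adjoint elements x
    of N ([strongly_adherent]); the elements 2x(1 + x^2)^-1 lie in the compact
    set F, and a limit point Z of them satisfies Z(1 + A^2) = 2A.  Applying this
    to small multiples of A and rescaling gives norm approximations of A by
    elements of N that stay in one dilate of F, so A belongs to N. *)

(** * Closed embeddings in countable powers of the real line *)

Section Coordinates.
Context {R : realType} (T : topologicalType) (I : countType).

(** The functions [g i] embed [T] as a closed subspace of the power of the real
    line indexed by [I]. The clause on filters, with the other two, yields at
    once that the topology of [T] is the initial one ([coord_cvg]) and that the
    image is closed; it is also the form in which compactness arguments deliver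
    it. *)
Definition coordinates (g : I -> T -> R) : Prop :=
  [/\ forall i, continuous (g i),
      forall x y, (forall i, g i x = g i y) -> x = y &
      forall F : set_system T, ProperFilter F ->
        (forall i, cvg (g i @ F)) -> exists l : T, F --> l].

Variable g : I -> T -> R.

(** The weights tend to 0 along the enumeration of [I], so that only finitely
    many coordinates matter at a given scale. *)
Definition coord_gap (x y : T) (i : I) : R :=
  Num.min (2^-1 ^+ pickle i) `|g i x - g i y|.

Definition coord_dist (x y : T) : R := sup (range (coord_gap x y)).

Lemma coord_gap_ge0 x y i : 0 <= coord_gap x y i.
Proof. by rewrite le_min normr_ge0 exprn_ge0 ?invr_ge0. Qed.

Lemma coord_gap_le x y i : coord_gap x y i <= coord_dist x y.
Proof.
apply: ub_le_sup; last by exists i.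
exists 1 => _ [j _ <-]; rewrite ge_min exprn_ile1 ?invr_ge0//.
by rewrite invf_le1 ?ler1n.
Qed.

Lemma coord_dist_le x y c :
  0 <= c -> (forall i, coord_gap x y i <= c) -> coord_dist x y <= c.
Proof.
move=> c0 xyc; rewrite /coord_dist.
have [->|/set0P ne] := eqVneq (range (coord_gap x y)) set0; first by rewrite sup0.
by apply: (ge_sup ne) => _ [i _ <-].
Qed.

Lemma coord_dist_ge0 x y : 0 <= coord_dist x y.
Proof.
rewrite /coord_dist.
have [->|/set0P[_ [i _ _]]] := eqVneq (range (coord_gap x y)) set0.
  by rewrite sup0.
exact: le_trans (coord_gap_ge0 x y i) (coord_gap_le x y i).
Qed.

Lemma coord_dist_sym x y : coord_dist x y = coord_dist y x.
Proof.
rewrite /coord_dist (_ : coord_gap x y = coord_gap y x)//.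
by apply/funext => i; rewrite /coord_gap distrC.
Qed.

Lemma coord_dist_triangle x y z :
  coord_dist x z <= coord_dist x y + coord_dist y z.
Proof.
apply: coord_dist_le => [|i]; first by rewrite addr_ge0 ?coord_dist_ge0.
apply: le_trans (lerD (coord_gap_le x y i) (coord_gap_le y z i)).
have p0 : 0 <= 2^-1 ^+ pickle i :> R by rewrite exprn_ge0 ?invr_ge0.
have := ler_distD (g i y) (g i x) (g i z); rewrite /coord_gap.
have := normr_ge0 (g i x - g i y); have := normr_ge0 (g i y - g i z).
by rewrite !minEle; repeat case: ifP; lra.
Qed.

Lemma coord_gap_lt x y i e : e <= 2^-1 ^+ pickle i -> coord_gap x y i < e ->
  `|g i x - g i y| < e.
Proof. by move=> ei; rewrite gt_min ltNge ei. Qed.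

(** Coordinates of large index contribute at most their weight, and the finitely
    many remaining ones converge. *)
Lemma near_coord_dist (F : set_system T) (FF : Filter F) (x : T) :
  (forall i, g i @ F --> g i x) ->
  forall e, 0 < e -> \forall y \near F, coord_dist x y < e.
Proof.
move=> gx e e0; have e20 : 0 < e / 2 by rewrite divr_gt0.
have [K _ KP] : \forall n \near \oo, `|2^-1 ^+ n| < e / 2.
  have : `|2^-1| < 1 :> R by rewrite ger0_norm ?invr_ge0// invf_lt1 ?ltr1n.
  by move/cvg_expr/cvgr0_norm_lt => /(_ _ e20).
have : \forall y \near F, forall i, (pickle i < K)%N -> `|g i x - g i y| < e / 2.
  elim: (K) => [|k IHk]; first by near=> y => i.
  have : \forall y \near F, forall i, pickle_inv k = Some i ->
      `|g i x - g i y| < e / 2.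
    case: pickle_inv => [i|]; last by near=> y.
    have /cvgrPdist_lt/(_ _ e20) := gx i.
    by apply: filterS => y xy _ [<-].
  apply: filterS2 IHk => y ylt yk i.
  rewrite ltnS leq_eqVlt => /predU1P[ik|]; last exact: ylt.
  by apply: yk; rewrite -ik pickleK_inv.
apply: filterS => y gy; apply: (@le_lt_trans _ _ (e / 2)); last first.
  by rewrite ltr_pdivrMr// ltr_pMr// ltr1n.
apply: coord_dist_le => [|i]; first exact: ltW.
rewrite ge_min; have [/gy/ltW->|Ki] := ltnP (pickle i) K; first by rewrite orbT.
have := KP _ Ki; rewrite ger0_norm ?exprn_ge0 ?invr_ge0//.
by move/ltW ->.
Unshelve. all: by end_near. Qed.

Hypothesis gC : coordinates g.

Let g_cont i : continuous (g i). Proof. by case: gC => + _ _; apply. Qed.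

(** The filter converges to some point by completeness, and the coordinates of
    that point are those of [x]. *)
Lemma coord_cvg (F : set_system T) (FF : ProperFilter F) (x : T) :
  (forall i, g i @ F --> g i x) -> F --> x.
Proof.
case: gC => _ sep cplt gx; have [i|l Fl] := cplt F FF; first exact: cvgP (gx i).
rewrite (sep x l)// => i; apply: (cvg_unique (@norm_hausdorff _ _) (gx i)).
by move=> A /(g_cont (i := i) (x := l))/Fl.
Qed.

Lemma cvg_coord_dist (F : set_system T) (FF : ProperFilter F) (x : T) :
  (forall e, 0 < e -> \forall y \near F, coord_dist x y < e) -> F --> x.
Proof.
move=> Fx; apply: coord_cvg => i; apply/cvgrPdist_lt => e e0.
have p0 : 0 < 2^-1 ^+ pickle i :> R by rewrite exprn_gt0 ?invr_gt0.
near=> y.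
have : coord_dist x y < Num.min e (2^-1 ^+ pickle i).
  by near: y; apply: Fx; rewrite lt_min e0.
move=> /(le_lt_trans (coord_gap_le x y i)) h.
have := coord_gap_lt _ h; rewrite ge_min lexx orbT => /(_ isT).
by rewrite lt_min => /andP[].
Unshelve. all: by end_near. Qed.

Lemma coord_dist_nbhs (x : T) (A : set T) : nbhs x A <->
  exists2 e : R, 0 < e & [set y | coord_dist x y < e] `<=` A.
Proof.
split=> [|[e e0 eA]]; last first.
  by apply: filterS eA _; apply: near_coord_dist e0 => i; exact: g_cont.
pose F := filter_from [set e : R | 0 < e] (fun e => [set y | coord_dist x y < e]).
have FF : ProperFilter F.
  apply: filter_from_proper => [|e /= e0]; last first.
    exists x; apply: le_lt_trans e0; apply: coord_dist_le => // i.
    by rewrite /coord_gap subrr normr0 ge_min lexx orbT.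
  apply: filter_from_filter; first by exists 1 => /=.
  move=> d e /= d0 e0; exists (Num.min d e) => [|y /=]; rewrite /= lt_min ?d0//.
  by case/andP.
by apply: (@cvg_coord_dist F) => e e0; exists e.
Qed.

Lemma coord_dist_separated x y : coord_dist x y = 0 <-> x = y.
Proof.
split=> [xy|->]; last first.
  apply/eqP; rewrite eq_le coord_dist_ge0 andbT coord_dist_le// => i.
  by rewrite /coord_gap subrr normr0 ge_min lexx orbT.
case: gC => _ sep _; apply: sep => i; apply/eqP; rewrite -subr_eq0 -normr_eq0.
have := coord_gap_le x y i; rewrite xy /coord_gap ge_min leNgt.
by rewrite exprn_gt0 ?invr_gt0//= normr_le0 normr_eq0.
Qed.

Lemma coord_dist_complete (u : nat -> T) :
  (forall e : R, 0 < e -> exists N, forall m n,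
     (N <= m)%N -> (N <= n)%N -> coord_dist (u m) (u n) < e) ->
  exists l : T, u @ \oo --> l.
Proof.
case: gC => _ _ cplt uC; apply: cplt => i.
apply/cauchy_cvgP/cauchy_exP => e e0.
have p0 : 0 < 2^-1 ^+ pickle i :> R by rewrite exprn_gt0 ?invr_gt0.
have [|N NP] := uC (Num.min e (2^-1 ^+ pickle i)); first by rewrite lt_min e0.
exists (g i (u N)); exists N => //= n /= Nn.
have := le_lt_trans (coord_gap_le _ _ i) (NP N n (leqnn _) Nn) => h.
have := coord_gap_lt _ h; rewrite ge_min lexx orbT => /(_ isT).
by rewrite lt_min -ball_normE /= => /andP[].
Qed.

(** A countable dense set is obtained by choosing a point in each nonempty
    finite rational box. *)
Lemma coord_separable : separable T.
Proof.
pose box (s : seq (I * (rat * rat))) : set T :=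
  [set x | all (fun t => ratr t.2.1 < g t.1 x < ratr t.2.2) s].
have [p0|/existsNP[p0 _]] := pselect (forall x : T, False).
  by exists set0; [exact: countable0|move=> O [x]; have := p0 x].
pose c s := xget p0 (box s).
exists (\bigcup_s [set c s]).
  by apply: bigcup_countable => // s _; exact: countable1.
move=> O [x Ox] oO.
pose F := filter_from [set s | box s x] box.
have FF : ProperFilter F.
  apply: filter_from_proper => [|s /=]; last by exists x.
  apply: filter_from_filter; first by exists [::].
  move=> s t /= sx tx; exists (s ++ t); first by rewrite /box /= all_cat sx.
  by move=> y; rewrite /box /= all_cat => /andP.
have Fx : F --> x.
  apply: coord_cvg => i; apply/cvgrPdist_lt => d d0.
  have [a] : exists a, ratr a \in `]g i x - d, g i x[.
    by apply: rat_in_itvoo; rewrite ltrBlDr ltrDl.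
  have [b] : exists b, ratr b \in `]g i x, g i x + d[.
    by apply: rat_in_itvoo; rewrite ltrDl.
  rewrite !in_itv /= => /andP[xb bd] /andP[da ax].
  exists [:: (i, (a, b))] => [|y] /=; rewrite /box /= andbT ?ax//.
  by move=> /andP[ay yb]; rewrite ltr_norml; lra.
have [s /= sx sO] := Fx O (open_nbhs_nbhs (conj oO Ox)).
have := @xgetPex _ p0 (box s) (ex_intro _ x sx) => sc.
by exists (c s); split; [exact: sO|exists s].
Qed.

(** A closed subspace of a countable power of the real line is Polish. *)
Lemma coord_polish : polish R T.
Proof.
split; first exact: coord_separable.
exists coord_dist; split.
- exact: coord_dist_separated.
- exact: coord_dist_sym.
- exact: coord_dist_triangle.
- exact: coord_dist_nbhs.
- exact: coord_dist_complete.
Qed.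

End Coordinates.

(** * G_delta subspaces of Polish spaces *)

Section GdeltaSubspace.
Context {R : realType} (T : topologicalType) (I : countType).
Variables (g : I -> T -> R) (gC : coordinates g).

(** Distance to the complement of [O], truncated at 1 so that [O] may be the
    whole space. *)
Definition codist (O : set T) (t : T) : R :=
  inf ([set 1] `|` [set coord_dist g t z | z in ~` O]).

Let lb_codist O t :
  lbound ([set 1] `|` [set coord_dist g t z | z in ~` O]) (0 : R).
Proof. by move=> _ [->//|[z _ <-]]; exact: coord_dist_ge0. Qed.

Lemma codist_ge0 O t : 0 <= codist O t.
Proof. by apply: lb_le_inf (@lb_codist O t); exists 1; left. Qed.

Lemma codist_le O t z : ~ O z -> codist O t <= coord_dist g t z.
Proof.
by move=> Oz; apply: ge_inf; [exists 0; exact: lb_codist|right; exists z].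
Qed.

Lemma codist_lipschitz O s t : codist O s <= coord_dist g s t + codist O t.
Proof.
rewrite -lerBlDl; apply: lb_le_inf; first by exists 1; left.
move=> _ [->|[z Oz <-]]; rewrite lerBlDl.
  rewrite (@le_trans _ _ 1) ?lerDr ?coord_dist_ge0//.
  by apply: ge_inf; [exists 0; exact: lb_codist|left].
exact: le_trans (codist_le s Oz) (coord_dist_triangle g s t z).
Qed.

Lemma codist_continuous O : continuous (codist O).
Proof.
move=> t; apply/cvgrPdist_lt => e e0.
have [gc _ _] := gC.
have := near_coord_dist (nbhs_filter t) (fun i => gc i t) e0.
apply: filterS => s ts; apply: le_lt_trans ts.
have := codist_lipschitz O t s; have := codist_lipschitz O s t.
by rewrite (coord_dist_sym g s t) ler_norml; lra.
Qed.

Lemma codist_gt0 O t : open O -> (0 < codist O t) = `[< O t >].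
Proof.
move=> oO; apply/idP/asboolP => [t0|Ot].
  apply: contrapT => /(codist_le t); rewrite (proj2 (coord_dist_separated gC t t))//.
  by rewrite leNgt t0.
have /(proj1 (coord_dist_nbhs gC t O))[e e0 eO] : nbhs t O.
  exact: open_nbhs_nbhs.
apply: (@lt_le_trans _ _ (Num.min 1 e)); first by rewrite lt_min ltr01.
apply: lb_le_inf; first by exists 1; left.
move=> _ [->|[z Oz <-]]; rewrite ge_min ?lexx//; apply/orP; right.
by rewrite leNgt; apply/negP => /eO.
Qed.

Variables (S : choiceType) (iota : S -> T) (O : nat -> set T).
Hypotheses (iota_inj : injective iota) (oO : forall j, open (O j)).
Hypothesis rangeO : range iota = \bigcap_j O j.

(** Adding the inverse distances to the complements of the open sets [O j]
    prevents a convergent sequence of coordinates from leaving their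
    intersection. *)
Definition Gdelta_coord (k : I + nat) (s : initial_topology iota) : R :=
  match k with
  | inl i => g i (iota s)
  | inr j => (codist (O j) (iota s))^-1
  end.

Lemma codist_iota_gt0 j s : 0 < codist (O j) (iota s).
Proof.
rewrite codist_gt0//; apply/asboolP.
have : range iota (iota s) by exists s.
by rewrite rangeO; apply.
Qed.

(** A limit in [T] exists because the coordinates [g] converge; it stays in each
    [O j] because the distance to the complement has an inverse that converges. *)
Lemma Gdelta_coordinates : coordinates Gdelta_coord.
Proof.
have [gc sep cplt] := gC.
have ic : continuous (iota : initial_topology iota -> T).
  exact: initial_continuous.
have dc j : continuous (codist (O j) \o iota : initial_topology iota -> R).
  by move=> s; apply: (@continuous_comp (initial_topology iota) _ _ iota (codist (O j)));
    [exact: ic|exact: codist_continuous].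
split=> [[i|j] s|s s' ss'|F FF Fcvg].
- by apply: (@continuous_comp (initial_topology iota) _ _ iota (g i));
    [exact: ic|exact: gc].
- by apply: (cvgV _ (dc j s)); rewrite /= gt_eqF ?codist_iota_gt0.
- by apply: iota_inj; apply: sep => i; exact: ss' (inl i).
have [t Ft] : exists t : T, iota @ F --> t.
  by apply: cplt => i; exact: Fcvg (inl i).
have [s _ st] : range iota t.
  rewrite rangeO => j _; apply: contrapT => Ojt.
  have /cvg_ex[/= c Fc] := Fcvg (inr j).
  have Fd : codist (O j) \o iota @ F --> codist (O j) t.
    apply: (@cvg_comp _ _ _ iota (codist (O j)) F (nbhs t)) => //.
    exact: codist_continuous.
  have := cvgM (FF := FF) Fd Fc; rewrite (_ : (_ \* _) = cst 1); last first.
    by apply/funext => s /=; rewrite mulfV// gt_eqF ?codist_iota_gt0.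
  move=> /(cvg_unique (@norm_hausdorff _ _) (cvg_cst (1 : R)))/eqP.
  have -> : codist (O j) t = 0.
    apply/eqP; rewrite eq_le codist_ge0 andbT leNgt codist_gt0//.
    by apply/negP => /asboolP.
  by rewrite mul0r oner_eq0.
exists s => A [_ [[B oB <-] Bs] BA].
rewrite nbhs_filterE; apply: filterS BA _.
by apply: Ft; rewrite -st; exact: open_nbhs_nbhs.
Qed.

End GdeltaSubspace.

(** Alexandrov's theorem, for a space carrying the topology induced by an
    injection with G_delta range. *)
Theorem Gdelta_polish {R : realType} (T : topologicalType) (I : countType)
    (g : I -> T -> R) (S : choiceType) (iota : S -> T) :
  coordinates g -> injective iota -> Gdelta (range iota) ->
  polish R (initial_topology iota).
Proof.
move=> gC iotaI [U oU rangeU].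
exact: coord_polish (Gdelta_coordinates gC iotaI oU rangeU).
Qed.

Lemma Gdelta_bigcap (T : topologicalType) (K : countType) (S : K -> set T) :
  (forall k, Gdelta (S k)) -> Gdelta (\bigcap_k S k).
Proof.
move=> /(_ _)/cid2-/all_sig2[U oU SE].
exists (fun n => if unpickle n is Some (k, m) then U k m else setT).
  by move=> n; case: unpickle => [[k m]|]; [exact: oU|exact: openT].
apply/seteqP; split=> x Sx.
  by move=> n _; case: unpickle => // -[k m]; have := Sx k I; rewrite SE; apply.
move=> k _; rewrite SE => m _; have := Sx (pickle (k, m)) I.
by rewrite pickleK.
Qed.

Lemma GdeltaI (T : topologicalType) (A B : set T) :
  Gdelta A -> Gdelta B -> Gdelta (A `&` B).
Proof.
move=> GA GB; rewrite (_ : A `&` B = \bigcap_(b : bool) (if b then A else B)).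
  by apply: Gdelta_bigcap; case.
apply/seteqP; split=> x; first by move=> [Ax Bx] [].
by move=> AB; split; [exact: (AB true)|exact: (AB false)].
Qed.

(** * The Vietoris topology of a compact space *)

Section VietorisCoordinates.
Context (X : topologicalType).
Implicit Types (U : set X) (F : closed_subsets X).

Lemma open_vietoris_subbase (B : set (closed_subsets X)) :
  vietoris_subbase B -> open B.
Proof.
move=> sB; exists [set B]; last by rewrite bigcup_set1.
move=> _ ->; exists [fset B]%fset; first by move=> C /fset1P->; apply/mem_set.
by rewrite set_fset1 bigcap_set1.
Qed.

Lemma open_hit U : open U -> open [set F : closed_subsets X | set_val F `&` U !=set0].
Proof. by move=> oU; apply: open_vietoris_subbase; left; exists U. Qed.

Lemma open_inside U : open U -> open [set F : closed_subsets X | set_val F `<=` U].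
Proof. by move=> oU; apply: open_vietoris_subbase; right; exists U. Qed.

(** Convergence only has to be tested on the subbase, since a filter is stable
    under finite intersections. *)
Lemma cvg_vietoris (Phi : set_system (closed_subsets X)) (FPhi : Filter Phi) F0 :
  (forall U, open U -> set_val F0 `&` U !=set0 ->
     \forall F \near Phi, set_val F `&` U !=set0) ->
  (forall U, open U -> set_val F0 `<=` U -> \forall F \near Phi, set_val F `<=` U) ->
  Phi --> F0.
Proof.
move=> hit ins A; rewrite nbhsE => -[V [[D sD <-] [B DB F0B]] VA].
have [/= K KD KB] := sD _ DB.
rewrite nbhs_filterE; apply: filterS VA _; apply: (@filterS _ _ _ B).
  by move=> F BF; exists B.
rewrite -KB; apply: filter_bigI => C KC.
have := F0B; rewrite -KB => /(_ C KC) CF0.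
have /set_mem[[U oU UC]|[U oU UC]] := KD _ KC; rewrite -UC.
  by apply: hit => //; move: CF0; rewrite -UC.
by apply: ins => //; move: CF0; rewrite -UC.
Qed.

Context {R : realType} (I : countType).

(** A base of open sets given with functions whose cozero sets they are: the
    values measure how deep a point lies in a basic set, which makes closed
    subsets comparable by suprema. *)
Definition cozero_base (f : I -> X -> R) : Prop :=
  [/\ forall i, continuous (f i), forall i x, 0 <= f i x <= 1 &
      forall x A, nbhs x A -> exists2 i, 0 < f i x & forall y, 0 < f i y -> A y].

Variable f : I -> X -> R.
Hypotheses (cX : compact [set: X]) (fB : cozero_base f).

(** The default value 0 of the supremum of the empty set is the right height for
    the empty closed set, as all the [f i] are nonnegative. *)
Definition height i F : R := sup [set f i x | x in set_val F].

Let f_cont i : continuous (f i). Proof. by have [+ _ _] := fB; apply. Qed.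
Let f_ge0 i x : 0 <= f i x. Proof. by have [_ /(_ i x)/andP[]] := fB. Qed.
Let f_le1 i x : f i x <= 1. Proof. by have [_ /(_ i x)/andP[]] := fB. Qed.

Lemma height_ge i F x : set_val F x -> f i x <= height i F.
Proof.
by move=> Fx; apply: ub_le_sup; [exists 1 => _ [y _ <-]|exists x].
Qed.

Lemma height_le i F c : 0 <= c -> (forall x, set_val F x -> f i x <= c) ->
  height i F <= c.
Proof.
move=> c0 Fc; rewrite /height.
have [->|/set0P ne] := eqVneq [set f i x | x in set_val F] set0.
  by rewrite sup0.
by apply: (ge_sup ne) => _ [x Fx <-]; exact: Fc.
Qed.

Lemma height_ge0 i F : 0 <= height i F.
Proof.
rewrite /height.
have [->|/set0P[_ [x Fx _]]] := eqVneq [set f i x | x in set_val F] set0.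
  by rewrite sup0.
exact: le_trans (f_ge0 i x) (height_ge i Fx).
Qed.

Lemma height_gt i F c : 0 <= c -> c < height i F ->
  exists2 x, set_val F x & c < f i x.
Proof.
move=> c0; rewrite ltNge => /negP Fc; apply: contrapT => nx; apply: Fc.
apply: height_le => // x Fx; rewrite leNgt; apply/negP => cx.
by apply: nx; exists x.
Qed.

(** The height exceeds c when the closed set meets the open set where [f i > c],
    and is below c when it is contained in the open set where [f i < c]: these
    are the two kinds of subbasic sets. *)
Lemma height_continuous i : continuous (height i).
Proof.
move=> F; apply/(@cvgrPdist_lt _ _ _ _ (nbhs_filter F)) => e e0.
have e20 : 0 < e / 2 by rewrite divr_gt0.
have FF : Filter (nbhs F) := nbhs_filter F.
have e2 : e / 2 < e by rewrite ltr_pdivrMr// ltr_pMr// ltr1n.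
have upper : \forall F' \near F, height i F' <= height i F + e / 2.
  have oU : open (f i @^-1` [set y | y < height i F + e / 2]).
    by apply: open_comp => [x _|]; [exact: f_cont|exact: open_lt].
  have : nbhs F [set F' | set_val F' `<=` f i @^-1` [set y | y < height i F + e / 2]].
    apply: open_nbhs_nbhs; split; first exact: open_inside.
    by move=> x Fx /=; rewrite (le_lt_trans (height_ge i Fx))// ltrDl.
  apply: filterS => F' F'U; apply: height_le => [|x /F'U/ltW//].
  by rewrite addr_ge0 ?height_ge0// ltW.
have lower : \forall F' \near F, height i F - e < height i F'.
  have [neg|pos] := ltP (height i F - e) 0.
    by near=> F'; exact: lt_le_trans neg (height_ge0 _ _).
  have oU : open (f i @^-1` [set y | height i F - e < y]).
    by apply: open_comp => [x _|]; [exact: f_cont|exact: open_gt].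
  have : nbhs F [set F' |
      set_val F' `&` (f i @^-1` [set y | height i F - e < y]) !=set0].
    apply: open_nbhs_nbhs; split; first exact: open_hit.
    have [|x Fx ex] := @height_gt i F (height i F - e) pos.
      by rewrite ltrBlDr ltrDl.
    by exists x.
  by apply: filterS => F' [x [F'x /lt_le_trans]]; apply; exact: height_ge.
near=> F'.
have h1 : height i F' <= height i F + e / 2 by near: F'.
have h2 : height i F - e < height i F' by near: F'.
by rewrite ltr_norml; lra.
Unshelve. all: by end_near. Qed.

(** The complement of the union of the basic sets on which the heights tend to
    0: the only possible limit of closed sets whose heights tend to [s]. *)
Definition limit_set (s : I -> R) : set X :=
  [set x | forall i, 0 < f i x -> 0 < s i].

Lemma closed_limit_set s : closed (limit_set s).
Proof.
rewrite (_ : limit_set s =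
    \bigcap_(i in [set i | ~~ (0 < s i)]) (f i @^-1` [set y | y <= 0])).
  apply: closed_bigI => i _; apply: closed_comp => [x _|]; first exact: f_cont.
  exact: closed_le.
apply/seteqP; split=> x /= sx i.
  by move=> /negP si /=; rewrite leNgt; apply/negP => /sx.
by move=> fx; apply: contraTT fx => /sx /=; rewrite leNgt.
Qed.

Definition limit_closed s : closed_subsets X :=
  exist _ (limit_set s) (mem_set (@closed_limit_set s)).

(** If the limit set meets U, it meets a basic subset of U whose limiting height
    is positive, and so do the closed sets near the limit. If it is contained in
    U, every point outside U lies in a basic set whose height tends to 0; by
    compactness of the complement of U, the closed sets near the limit avoid it. *)
Lemma heights_cvg (Phi : set_system (closed_subsets X)) (FPhi : Filter Phi)
    (s : I -> R) :
  (forall i, height i @ Phi --> s i) -> Phi --> limit_closed s.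
Proof.
move=> Phis; apply: cvg_vietoris => U oU.
  move=> [x [/= sx Ux]].
  have [_ _ /(_ x U (open_nbhs_nbhs (conj oU Ux)))[i fx fU]] := fB.
  have si := sx i fx.
  have /cvgrPdist_lt/(_ _ si) := Phis i; apply: filterS => F.
  rewrite ltr_norml => /andP[_]; rewrite ltrBlDl -ltrBlDr subrr => Fi.
  have [y Fy fy] := height_gt (lexx 0) Fi.
  by exists y; split => //; exact: fU.
move=> sU; have : compact (~` U).
  by apply: (subclosed_compact _ cX) => //; exact: open_closedC.
rewrite compact_near_coveringP => /(_ _ Phi (fun F x => ~ set_val F x)) h.
(* The near-covering form of compactness turns a statement local around
   each point outside U into a uniform one. *)
suff : \forall F \near Phi, ~` U `<=` [set x | ~ set_val F x].
  by apply: filterS => F FU x Fx; apply: contrapT => /FU.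
apply: h => x Ux.
have : ~ limit_set s x by move=> /sU.
move=> /existsNP[i /not_implyP[fx /negP]]; rewrite -leNgt => si.
have fx2 : 0 < f i x / 2 by rewrite divr_gt0.
have nx : \forall y \near x, f i x / 2 < f i y.
  have /cvgrPdist_lt/(_ _ fx2) := @f_cont i x.
  by apply: filterS => y; rewrite ltr_norml => /andP[_]; lra.
have nF : \forall F \near Phi, height i F < f i x / 2.
  have /cvgrPdist_lt/(_ _ fx2) := Phis i; apply: filterS => F.
  by rewrite ltr_norml => /andP[]; lra.
near=> y F => Fy.
have h1 : f i x / 2 < f i y by near: y.
have h2 : height i F < f i x / 2 by near: F.
by have := lt_trans (le_lt_trans (height_ge i Fy) h2) h1; rewrite ltxx.
Unshelve. all: by end_near. Qed.

(** A closed set is recovered from its heights, because its complement is a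
    union of basic sets. *)
Lemma mem_heightsP F x : set_val F x <-> limit_set (height^~ F) x.
Proof.
split=> [Fx i fx|Fx]; first exact: lt_le_trans fx (height_ge i Fx).
apply: contrapT => nFx; have cF : closed (set_val F) by exact: set_valP.
have [_ _ /(_ x (~` set_val F))[|i fx fF]] := fB.
  by apply: open_nbhs_nbhs; split => //; exact: closed_openC.
have [y Fy fy] := height_gt (lexx 0) (Fx i fx).
exact: fF Fy.
Qed.

Lemma height_coordinates : coordinates height.
Proof.
split=> [i|F G FG|Phi FPhi Phic]; first exact: height_continuous.
  apply: val_inj; apply/seteqP; split=> x.
    by move/mem_heightsP => Fx; apply/mem_heightsP => i; rewrite -FG; apply: Fx.
  by move/mem_heightsP => Fx; apply/mem_heightsP => i; rewrite FG; apply: Fx.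
exists (limit_closed (fun i => lim (height i @ Phi))).
by apply: heights_cvg => i; exact: Phic.
Qed.

End VietorisCoordinates.

(** * A countable base from a countable separating family *)

Section CozeroBase.
Context {R : realType} (X : topologicalType) (J : countType).
Variable r : J -> X -> R.
Hypotheses (cX : compact [set: X]) (r_cont : forall j, continuous (r j)).
Hypothesis r_sep : forall x y, (forall j, r j x = r j y) -> x = y.

(** The cozero set is an open box in finitely many coordinates ([bump_gt0]);
    rational bounds keep the index set countable. *)
Definition bump (s : seq (J * (rat * rat))) (x : X) : R :=
  foldr (fun t m => Num.min
    (Num.max 0 (Num.min (r t.1 x - ratr t.2.1) (ratr t.2.2 - r t.1 x))) m) 1 s.

Lemma bump_gt0 s x :
  (0 < bump s x) = all (fun t => ratr t.2.1 < r t.1 x < ratr t.2.2) s.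
Proof.
elim: s => [|t s IHs] /=; first by rewrite ltr01.
by rewrite lt_min IHs lt_max ltxx lt_min !subr_gt0.
Qed.

Lemma bump_bound s x : 0 <= bump s x <= 1.
Proof.
elim: s => [|t s /andP[s0 s1]] /=; first by rewrite lexx ler01.
by rewrite le_min s0 le_max lexx /= ge_min s1 orbT.
Qed.

Lemma bump_continuous s : continuous (bump s).
Proof.
elim: s => [|t s IHs] x; first exact: cvg_cst.
apply: continuous_min (IHs x); apply: continuous_max; first exact: cvg_cst.
apply: continuous_min; first by apply: cvgB; [exact: r_cont|exact: cvg_cst].
by apply: cvgB; [exact: cvg_cst|exact: r_cont].
Qed.

(** A continuous injection of a compact space into a Hausdorff one is an
    embedding; here the target is the power of the real line given by [r]. *)
Lemma bump_cozero_base : cozero_base bump.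
Proof.
split=> [|s x|x A Ax]; [exact: bump_continuous|exact: bump_bound|].
pose Phi := filter_from [set s | 0 < bump s x] (fun s => [set y | 0 < bump s y]).
have FPhi : Filter Phi.
  apply: filter_from_filter; first by exists [::]; rewrite /= ltr01.
  move=> s t /= sx tx; exists (s ++ t) => [|y] /=.
    by rewrite bump_gt0 all_cat -!bump_gt0 sx.
  by rewrite !bump_gt0 all_cat => /andP.
suff [s sx sA] : Phi A by exists s.
have := cX; rewrite compact_near_coveringP.
move=> /(_ _ Phi (fun y z => y = z -> A y)) near_diag.
(* The set A belongs to the filter Phi of box neighbourhoods of x as soon
   as, around every point z of the compact space, the points of A are the
   only ones that Phi cannot separate from z. *)
have := near_diag FPhi.
suff h : forall z, [set: X] z -> \forall z' \near z & y \near Phi, y = z' -> A y.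
  by move=> /(_ h); apply: filterS => y /(_ y I); apply.
move=> z _; have [<-|xz] := pselect (x = z).
  by exists (A, setT) => [|[z' y] [Az' _] ->]; [split=> //; exact: filterT|].
have [j rj] : exists j, r j x <> r j z.
  by apply/existsNP => /r_sep.
pose e := `|r j x - r j z| / 2.
have e0 : 0 < e by rewrite divr_gt0// normr_gt0 subr_eq0; apply/eqP.
have nz : \forall z' \near z, `|r j z - r j z'| < e.
  by have /cvgrPdist_lt/(_ _ e0) := @r_cont j z.
have ny : Phi [set y | `|r j x - r j y| < e].
  have [a] : exists a, ratr a \in `]r j x - e, r j x[.
    by apply: rat_in_itvoo; rewrite ltrBlDr ltrDl.
  have [b] : exists b, ratr b \in `]r j x, r j x + e[.
    by apply: rat_in_itvoo; rewrite ltrDl.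
  rewrite !in_itv /= => /andP[xb bd] /andP[da ax].
  pose s := [:: (j, (a, b))].
  have sE y : (0 < bump s y) = (ratr a < r j y < ratr b).
    by rewrite bump_gt0 /= andbT.
  exists s => [|y sy]; first by have := sE x; rewrite ax xb.
  have : ratr a < r j y < ratr b by rewrite -sE.
  by move=> /andP[ay yb]; rewrite /= ltr_norml; lra.
near=> z' y => yz'; exfalso.
have h1 : `|r j z - r j z'| < e by near: z'.
have h2 : `|r j x - r j y| < e by near: y.
have := ler_distD (r j y) (r j x) (r j z); rewrite leNgt => /negP; apply.
move: yz' h2 => /= -> h2.
by rewrite [ltRHS](splitr _) ltrD// distrC.
Unshelve. all: by end_near. Qed.

End CozeroBase.

(** * Stability under operations is a G_delta condition *)

Section StableSets.
Context {R : realType} (X : topologicalType) (I : countType).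
Variables (f : I -> X -> R) (fB : cozero_base f).

(** Operations are represented by their graphs [G], so that families of
    operations and partial operations are covered. *)
Definition stable (G : X -> X -> X -> Prop) (F : set X) :=
  forall x y z, F x -> F y -> G x y z -> F z.

(** Rectangles, rather than arbitrary closed sets of pairs, are used because a
    closed set meets A x B in its square exactly when it meets A and meets B: no
    topology on the square is needed. *)
Definition sigma_rectangular (W : X -> X -> Prop) := exists A B : nat -> set X,
  [/\ forall n, closed (A n), forall n, closed (B n) &
      forall x y, W x y <-> exists n, A n x /\ B n y].

Lemma sigma_rectangular_count (K : countType) (A B : K -> set X) :
  (forall k, closed (A k)) -> (forall k, closed (B k)) ->
  sigma_rectangular (fun x y => exists k, A k x /\ B k y).
Proof.
move=> cA cB; exists (fun n => if unpickle n is Some k then A k else set0),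
  (fun n => if unpickle n is Some k then B k else set0).
split=> [n|n|x y]; try by case: unpickle => // *; exact: closed0.
split=> [[k]|[n]]; first by exists (pickle k); rewrite pickleK.
by case: unpickle => [k|[]//]; exists k.
Qed.

(** Stability fails when some basic set i misses F while F meets both sides of
    one of the rectangles covering the pairs that [G] sends into i. The
    complement of each such failure is a union of three subbasic open sets. *)
Lemma Gdelta_stable (G : X -> X -> X -> Prop) :
  (forall i, sigma_rectangular (fun x y => exists2 z, 0 < f i z & G x y z)) ->
  Gdelta [set F : closed_subsets X | stable G (set_val F)].
Proof.
have [fc _ fbase] := fB.
move=> /(_ _)/cid-/all_sig[A] /(_ _)/cid-/all_sig[B AB].
pose O (t : I * nat) : set (closed_subsets X) :=
  [set F | set_val F `<=` ~` A t.1 t.2] `|`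
  [set F | set_val F `<=` ~` B t.1 t.2] `|`
  [set F | set_val F `&` [set x | 0 < f t.1 x] !=set0].
have -> : [set F : closed_subsets X | stable G (set_val F)] = \bigcap_t O t.
  apply/seteqP; split=> F /= FG.
    move=> [i n] _; rewrite /O /=; apply: contrapT => /not_orP[/not_orP[]].
    move=> /existsNP[x /not_implyP[Fx /contrapT Ax]].
    move=> /existsNP[y /not_implyP[Fy /contrapT By]]; apply.
    have [_ _ ABi] := AB i.
    have [|z fz Gz] := proj2 (ABi x y); first by exists n.
    by exists z; split=> //; exact: FG Gz.
  move=> x y z Fx Fy Gz; apply: contrapT => Fz.
  have cF : closed (set_val F) by exact: set_valP.
  have [|i fz fF] := fbase z (~` set_val F).
    by apply: open_nbhs_nbhs; split => //; exact: closed_openC.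
  have [_ _ ABi] := AB i.
  have [|n [An Bn]] := proj1 (ABi x y); first by exists z.
  have [[/(_ x Fx)//|/(_ y Fy)//]|[w [Fw /fF]]] := FG (i, n) Logic.I.
  exact.
apply: Gdelta_bigcap => -[i n]; apply: open_Gdelta.
have [cA cB _] := AB i.
apply: openU; last first.
  apply: open_hit; apply: open_comp (open_gt (y := 0)) => x _; exact: fc.
by apply: openU; apply: open_inside; exact: closed_openC.
Qed.

Lemma cozero_exhaust i z : 0 < f i z <-> exists n : nat, n.+1%:R^-1 <= f i z.
Proof.
split=> [fz|[n]]; last by apply: lt_le_trans; rewrite invr_gt0.
have /ltr_add_invr[n] := fz.
by rewrite add0r => /ltW; exists n.
Qed.

Lemma closed_superlevel i c : closed [set z | c <= f i z].
Proof.
have [fc _ _] := fB; rewrite -[X in closed X]/(f i @^-1` [set y | c <= y]).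
by apply: closed_comp => [x _|]; [exact: fc|exact: closed_ge].
Qed.

(** The point (x, y) is sent into the basic set i if and only if there are p and
    a basic neighbourhood a of x with [f i (m x' y)] at least 1/(p+1) for all x'
    in a. For fixed p and a the condition on y is closed, by continuity in y,
    and membership of x in a is exhausted by superlevel sets; continuity in x
    produces a and p. *)
Lemma sigma_rectangular_op (m : X -> X -> X) :
  (forall y, continuous (m^~ y)) -> (forall x, continuous (m x)) ->
  forall i, sigma_rectangular (fun x y => exists2 z, 0 < f i z & z = m x y).
Proof.
have [fc _ fbase] := fB.
move=> ml mr i.
pose A (k : nat * I * nat) : set X := [set x | k.2.+1%:R^-1 <= f k.1.2 x].
pose B (k : nat * I * nat) : set X :=
  \bigcap_(x' in [set x' | 0 < f k.1.2 x'])
    (m x' @^-1` [set z | k.1.1.+1%:R^-1 <= f i z]).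
have cA k : closed (A k) by exact: closed_superlevel.
have cB k : closed (B k).
  apply: closed_bigI => x' _; apply: closed_comp => [y _|]; first exact: mr.
  exact: closed_superlevel.
have := sigma_rectangular_count cA cB; congr sigma_rectangular.
apply/funext => x; apply/funext => y; apply/propext; split.
  move=> [[[n a] l] [/= Ax By]]; exists (m x y) => //; apply/cozero_exhaust.
  by exists n; apply: By => /=; apply/cozero_exhaust; exists l.
move=> [_ /[swap] -> fm].
have /ltr_add_invr[p] := fm; rewrite add0r => pf.
have [|a ax af] := fbase x (fun x' => p.+1%:R^-1 <= f i (m x' y)).
  have : (f i \o m^~ y) @ x --> f i (m x y).
    by apply: continuous_comp; [exact: ml|exact: fc].
  move=> /cvgrPdist_lt; rewrite -subr_gt0 in pf => /(_ _ pf).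
  apply: filterS => x' /=; rewrite ltr_norml => /andP[_].
  by rewrite ltrD2l ltrN2 => /ltW.
have /cozero_exhaust[l al] := ax.
by exists (p, a, l); split=> // x' /af.
Qed.

(** The condition on x is open, and an open set is the union of the superlevel
    sets of the basic functions whose cozero set it contains. *)
Lemma sigma_rectangular_family (K : Type) (m : K -> X -> X) :
  (forall k, continuous (m k)) ->
  forall i, sigma_rectangular
    (fun x _ => exists2 z, 0 < f i z & exists k, z = m k x).
Proof.
have [fc _ fbase] := fB.
move=> mc i; pose U := \bigcup_k (m k @^-1` [set z | 0 < f i z]).
pose A (k : I * nat) : set X :=
  [set x | (forall y, 0 < f k.1 y -> U y) /\ k.2.+1%:R^-1 <= f k.1 x].
have cA k : closed (A k).
  have [kU|nkU] := pselect (forall y, 0 < f k.1 y -> U y).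
    rewrite (_ : A k = [set x | k.2.+1%:R^-1 <= f k.1 x]).
      exact: closed_superlevel.
    by apply/seteqP; split=> x // [].
  by rewrite (_ : A k = set0); [exact: closed0|apply/seteqP; split=> x // -[]].
have := sigma_rectangular_count cA (fun=> closedT); congr sigma_rectangular.
apply/funext => x; apply/funext => y; apply/propext; split.
  move=> [[a n] [[aU ax] _]]; have [|k _ mk] := aU x.
    by apply/cozero_exhaust; exists n.
  by exists (m k x) => //; exists k.
move=> [_ /[swap] -[k ->] fm].
have [|a ax aU] := fbase x U.
  apply: open_nbhs_nbhs; split; last by exists k.
  apply: bigcup_open => k' _; apply: open_comp => [z _|]; first exact: mc.
  by apply: open_comp (open_gt (y := 0)) => z' _; exact: fc.
have /cozero_exhaust[n an] := ax.
by exists (a, n).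
Qed.

(** The graph of the inverse of [h]: the condition on x is to be in the image
    under [h] of a cozero set, which is a countable union of compact superlevel
    sets. *)
Lemma sigma_rectangular_inv (h : X -> X) :
  compact [set: X] -> hausdorff_space X -> continuous h ->
  forall i, sigma_rectangular (fun x _ => exists2 z, 0 < f i z & x = h z).
Proof.
move=> cX hX hc i.
have cA n : closed (h @` [set z | n.+1%:R^-1 <= f i z]).
  apply: compact_closed => //; apply: continuous_compact.
    exact: continuous_subspaceT.
  by apply: subclosed_compact cX _ => //; exact: closed_superlevel.
have := sigma_rectangular_count cA (fun=> closedT); congr sigma_rectangular.
apply/funext => x; apply/funext => y; apply/propext; split.
  by move=> [n [[z nz <-] _]]; exists z => //; apply/cozero_exhaust; exists n.
by move=> [z /cozero_exhaust[n nz] ->]; exists n; split=> //; exists z.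
Qed.

End StableSets.

(** * Minimization for positive semidefinite forms *)

Local Notation "x %:C" := (real_complex _ x).
Local Notation Re := complex.Re.
Local Notation Im := complex.Im.

(** The discriminant inequality; the sign of q is a consequence of the
    hypothesis, and q may be 0. *)
Lemma sqr_le_mul_of_quadratic {R : realType} (p q s : R) :
  (forall t, 0 <= t ^+ 2 * q - 2 * (t * p) + s) -> p ^+ 2 <= q * s.
Proof.
move=> pos; have q0 : 0 <= q.
  rewrite leNgt; apply/negP => q0.
  have s0 : 0 <= s by have := pos 0; rewrite expr0n /=; lra.
  pose t := (1 + s + 2 * `|p|) / - q + 1.
  have t1 : 1 <= t.
    by rewrite lerDr divr_ge0 ?oppr_ge0 ?(ltW q0)// !addr_ge0// mulr_ge0.
  have tq : t * - q = 1 + s + 2 * `|p| - q.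
    by rewrite /t mulrDl divfK ?mul1r// oppr_eq0 lt_eqF.
  have := pos t; have := ler_norm (- p); rewrite normrN => pn.
  have : t ^+ 2 * q = - (t * (1 + s + 2 * `|p| - q)) by rewrite -tq; ring.
  by move=> ->; have := normr_ge0 p; nra.
have [q_eq0|qn0] := eqVneq q 0.
  have [->|p0] := eqVneq p 0; first by rewrite q_eq0 mul0r expr0n.
  have := pos ((s + 1) / (2 * p)); rewrite q_eq0 mulr0 add0r.
  have -> : 2 * ((s + 1) / (2 * p) * p) = s + 1 by field.
  lra.
have qp : 0 < q by rewrite lt_def qn0.
have := pos (p / q).
have -> : (p / q) ^+ 2 * q - 2 * (p / q * p) + s = s - p ^+ 2 / q by field.
by rewrite subr_ge0 ler_pdivrMr// mulrC.
Qed.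

Section PositiveForm.
Context {R : realType} (E : lmodType R[i]) (b : E -> E -> R).
Hypotheses (bC : forall x y, b x y = b y x)
  (bD : forall x y z, b (x + y) z = b x z + b y z)
  (bZ : forall (t : R) x y, b (t%:C *: x) y = t * b x y)
  (b_ge0 : forall x, 0 <= b x x).

Lemma form_subZ_sq x y (t : R) :
  b (x - t%:C *: y) (x - t%:C *: y) =
  t ^+ 2 * b y y - 2 * (t * b x y) + b x x.
Proof.
have bN u v : b (- u) v = - b u v.
  by rewrite -scaleN1r -(rmorphN1 (real_complex R)) bZ mulN1r.
rewrite bD bN bZ ![b _ (_ - _)]bC !bD !bN !bZ (bC y x); ring.
Qed.

Lemma form_CauchySchwarz x y : b x y ^+ 2 <= b x x * b y y.
Proof.
rewrite mulrC; apply: sqr_le_mul_of_quadratic => t.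
by rewrite -form_subZ_sq.
Qed.

(** The projection theorem without completeness: a sequence minimizing the
    distance of [e] to the real subspace [K] is Cauchy by the parallelogram
    identity, and [e - k n] is orthogonal to [K] up to an error given by the
    variational inequality. Completeness enters only where a limit exists in the
    intended sense. *)
Lemma minimizing_sequence (K : set E) (e : E) :
  K 0 -> (forall x y, K x -> K y -> K (x + y)) ->
  (forall (t : R) x, K x -> K (t%:C *: x)) ->
  exists2 k : nat -> E, (forall n, K (k n)) &
    (forall n x, K x -> b (e - k n) x ^+ 2 <= b x x / n.+1%:R) /\
    (forall N m n, (N <= m)%N -> (N <= n)%N ->
       b (k m - k n) (k m - k n) <= 4 / N.+1%:R).
Proof.
move=> K0 KD KZ; pose Q k := b (e - k) (e - k); pose I := inf (Q @` K).
have lbQ : has_inf (Q @` K).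
  by split; [exists (Q 0), 0|exists 0 => _ [k _ <-]; exact: b_ge0].
have IQ k : K k -> I <= Q k by move=> Kk; apply: ge_inf; [case: lbQ|exists k].
have near_min n : {k | K k /\ Q k < I + n.+1%:R^-1}.
  have n0 : 0 < n.+1%:R^-1 :> R by rewrite invr_gt0.
  by apply: cid; have [_ [k Kk <-] Qk] := inf_adherent n0 lbQ; exists k.
exists (fun n => sval (near_min n)) => [n|]; first by case: (near_min n) => k [].
split=> [n x Kx|N m n Nm Nn].
  case: (near_min n) => k [Kk Qk] /=.
  apply: sqr_le_mul_of_quadratic => t.
  have := IQ (k + t%:C *: x) (KD _ _ Kk (KZ _ _ Kx)).
  rewrite {1}/Q opprD addrA form_subZ_sq -/(Q k) => h.
  move: Qk h; move: (I) (Q k) (n.+1%:R^-1) => i q d.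
  by move: (t ^+ 2 * _) (t * _) => u v; lra.
case: (near_min m) (near_min n) => [k [Kk Qk]] [l [Kl Ql]] /=.
have Nle p : (N <= p)%N -> p.+1%:R^-1 <= N.+1%:R^-1 :> R.
  by move=> Np; rewrite lef_pV2 ?posrE// ler_nat ltnS.
(* The midpoint of k and l is also in K, so its distance to e is at least
   the infimum. *)
have := IQ _ (KZ 2^-1 _ (KD _ _ Kk Kl)).
rewrite /Q form_subZ_sq => mid.
have bN u v : b (- u) v = - b u v.
  by rewrite -scaleN1r -(rmorphN1 (real_complex R)) bZ mulN1r.
move: Qk Ql mid (Nle _ Nm) (Nle _ Nn); rewrite /Q.
rewrite !bD ![b _ (_ + _)]bC !bD !bN (bC k e) (bC l e) (bC l k).
rewrite !(bC _ (- _)) !bN (bC k e) (bC l e) (bC l k) expr2.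
move: (b e e) (b e k) (b e l) (b k k) (b k l) (b l l) => ee ek el kk kl ll.
move: (I) (m.+1%:R^-1) (n.+1%:R^-1) (N.+1%:R^-1) => i u v w.
lra.
Qed.

End PositiveForm.

(** * Hilbert spaces as real inner product spaces *)

Lemma ReD {R : realType} (a b : R[i]) : Re (a + b) = Re a + Re b.
Proof. by case: a b => ? ? []. Qed.

Lemma ReN {R : realType} (a : R[i]) : Re (- a) = - Re a.
Proof. by case: a. Qed.

Section HilbertSpace.
Context {R : realType} (H : hilbertType R).
Implicit Types x y z : H.

(** The real part of the inner product determines it ([Im_inner]); with the real
    norm [nrm] it keeps all estimates in an ordered field. *)
Definition re x y : R := Re (inner x y).
Definition nrm x : R := Re `|x|.

Lemma nrmE x : `|x| = (nrm x)%:C.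
Proof. by rewrite /nrm RRe_real// normr_real. Qed.

Lemma nrm_ge0 x : 0 <= nrm x.
Proof. by rewrite -ler0c -nrmE. Qed.

Lemma nrmD x y : nrm (x + y) <= nrm x + nrm y.
Proof. by rewrite -lecR rmorphD /= -!nrmE ler_normD. Qed.

Lemma nrmN x : nrm (- x) = nrm x.
Proof. by rewrite /nrm normrN. Qed.

Lemma nrmB x y : nrm (x - y) <= nrm x + nrm y.
Proof. by rewrite -(nrmN y) nrmD. Qed.

Lemma nrmZc (c : R[i]) x : nrm (c *: x) = Re `|c| * nrm x.
Proof.
apply: complexI; rewrite -nrmE normrZ rmorphM /= -nrmE.
by rewrite (RRe_real (normr_real c)).
Qed.

Lemma nrmZ (t : R) x : nrm (t%:C *: x) = `|t| * nrm x.
Proof. by rewrite nrmZc normc_def /= expr0n /= addr0 sqrtr_sqr. Qed.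

Lemma nrm0 : nrm 0 = 0.
Proof. by rewrite /nrm normr0. Qed.

Lemma nrm_eq0 x : nrm x = 0 -> x = 0.
Proof. by move=> x0; apply/eqP; rewrite -normr_eq0 nrmE x0. Qed.

Lemma re_nrm x : re x x = nrm x ^+ 2.
Proof. by rewrite /re inner_norm nrmE -rmorphXn. Qed.

Lemma innerC x y : inner x y = (inner y x)^*%C.
Proof. by rewrite hermC expr0 mul1r. Qed.

Lemma reC x y : re x y = re y x.
Proof. by rewrite /re innerC; case: (inner y x). Qed.

Lemma reDl x y z : re (x + y) z = re x z + re y z.
Proof. by rewrite /re linearDl; exact: ReD. Qed.

Lemma reZl (t : R) x y : re (t%:C *: x) y = t * re x y.
Proof.
by rewrite /re linearZl_LR /=; case: (inner x y) => ? ?; rewrite /= mul0r subr0.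
Qed.

Lemma reNl x y : re (- x) y = - re x y.
Proof. by rewrite /re linearNl; exact: ReN. Qed.

Lemma re_ge0 x : 0 <= re x x.
Proof. by rewrite re_nrm sqr_ge0. Qed.

Lemma re0l x : re 0 x = 0.
Proof. by rewrite -(subrr x) reDl reNl subrr. Qed.

Lemma reDr x y z : re x (y + z) = re x y + re x z.
Proof. by rewrite reC reDl !(reC x). Qed.

Lemma reZr (t : R) x y : re x (t%:C *: y) = t * re x y.
Proof. by rewrite reC reZl reC. Qed.

Lemma reNr x y : re x (- y) = - re x y.
Proof. by rewrite reC reNl reC. Qed.

Lemma re_le x y : `|re x y| <= nrm x * nrm y.
Proof.
rewrite -ler_sqr ?nnegrE ?mulr_ge0 ?nrm_ge0// real_normK ?num_real// exprMn.
rewrite -!re_nrm.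
exact: (form_CauchySchwarz reC reDl reZl re_ge0).
Qed.

Lemma Im_inner x y : Im (inner x y) = re x ('i%C *: y).
Proof.
rewrite /re linearZr_LR /=; case: (inner x y) => a b /=.
by rewrite /Num.conj /= mul0r sub0r mulN1r opprK.
Qed.

Lemma re_inj x y : (forall w, re x w = re y w) -> x = y.
Proof.
move=> xy; apply/eqP; rewrite -subr_eq0; apply/eqP/nrm_eq0/eqP.
by rewrite -sqrf_eq0 -re_nrm reDl reNl xy subrr.
Qed.

Lemma nrm_cauchy_cvg (u : nat -> H) :
  (forall e : R, 0 < e -> exists N, forall m n, (N <= m)%N -> (N <= n)%N ->
     nrm (u m - u n) < e) ->
  exists v, forall e : R, 0 < e -> \forall n \near \oo, nrm (v - u n) < e.
Proof.
move=> uC; have : cvgn u.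
  apply/cauchy_cvgP/cauchy_exP => e; rewrite ltcE /= => /andP[/eqP e0 Re0].
  have [N NP] := uC _ Re0; exists (u N), N => // n /= Nn.
  by rewrite -ball_normE /= nrmE ltcE /= e0 eqxx NP.
move=> /cvg_ex[v uv]; exists v => e e0.
move/cvgrPdist_lt : uv => /(_ e%:C); rewrite ltcR => /(_ e0).
by apply: filterS => n; rewrite nrmE ltcR.
Qed.

Lemma nrm_cauchy_sq (u : nat -> H) :
  (forall N m n, (N <= m)%N -> (N <= n)%N ->
     nrm (u m - u n) ^+ 2 <= 4 / N.+1%:R) ->
  exists v, forall e : R, 0 < e -> \forall n \near \oo, nrm (v - u n) < e.
Proof.
move=> uC; apply: nrm_cauchy_cvg => e e0.
have e20 : 0 < e ^+ 2 / 4 by rewrite divr_gt0// exprn_gt0.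
have /ltr_add_invr[N] := e20; rewrite add0r => Ne.
exists N => m n Nm Nn; rewrite -ltr_sqr ?nnegrE ?nrm_ge0 ?(ltW e0)//.
apply: le_lt_trans (uC N m n Nm Nn) _.
by rewrite mulrC -ltr_pdivlMr.
Qed.

(** The difference v between a vector with psi = 1 and its projection on the
    kernel of psi is orthogonal to that kernel; psi is the inner product with v
    divided by its squared norm. *)
Lemma riesz (psi : H -> R) (c : R) :
  (forall x y, psi (x + y) = psi x + psi y) ->
  (forall t x, psi (t%:C *: x) = t * psi x) ->
  (forall x, `|psi x| <= c * nrm x) ->
  exists y, forall x, psi x = re y x.
Proof.
move=> psiD psiZ psic.
have psiN x : psi (- x) = - psi x.
  by rewrite -scaleN1r -(rmorphN1 (real_complex R)) psiZ mulN1r.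
have [e psi_e] : exists e, (exists x, psi x != 0) -> psi e = 1.
  have [[x x0]|n] := pselect (exists x, psi x != 0); last by exists 0 => /n.
  by exists ((psi x)^-1%:C *: x) => _; rewrite psiZ mulVf.
have [[x0 /[dup] nz /(ex_intro _ x0)/psi_e {}psi_e]|psi0] :=
    pselect (exists x, psi x != 0); last first.
  exists 0 => x; rewrite re0l; apply/eqP/negPn/negP => x0.
  by apply: psi0; exists x.
have psi_0 : psi 0 = 0 by rewrite -(subrr e) psiD psiN subrr.
have [||| k k0 [k_orth k_cauchy]] :=
  minimizing_sequence reC reDl reZl re_ge0 (K := [set x | psi x = 0]) e.
- exact: psi_0.
- by move=> x y /= x0' y0; rewrite psiD x0' y0 addr0.
- by move=> t x /= x0'; rewrite psiZ x0' mulr0.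
have [w kw] : exists v, forall d : R, 0 < d ->
    \forall n \near \oo, nrm (v - k n) < d.
  by apply: nrm_cauchy_sq => N m n Nm Nn; rewrite -re_nrm k_cauchy.
have c0 : 0 <= c.
  have := le_trans (normr_ge0 _) (psic e).
  rewrite pmulr_lge0// lt_def nrm_ge0 andbT; apply/negP => /eqP/nrm_eq0 e0.
  by move: psi_e; rewrite e0 psi_0 => /esym/eqP; rewrite oner_eq0.
have psiw : psi w = 0.
  apply/eqP; rewrite -normr_eq0 eq_le normr_ge0 andbT; apply/ler_addgt0Pr => d d0.
  have /kw[N _ /(_ N (leqnn _)) wN] : 0 < d / (c + 1).
    by rewrite divr_gt0// ltr_wpDl.
  have -> : w = (w - k N) + k N by rewrite subrK.
  rewrite psiD k0 addr0 add0r (le_trans (psic _))//.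
  apply: (@le_trans _ _ (c * (d / (c + 1)))); first by rewrite ler_wpM2l// ltW.
  rewrite mulrCA ger_pMr// ler_pdivrMr ?mul1r ?lerDl//.
  by rewrite ltr_wpDl.
pose v := e - w.
have v_orth x : psi x = 0 -> re v x = 0.
  move=> x_0; apply/eqP; rewrite -normr_eq0 eq_le normr_ge0 andbT.
  apply/ler_addgt0Pr => d d0; rewrite add0r.
  pose d' := d / 2 / (nrm x + 1).
  have x1 : 0 < nrm x + 1 by rewrite ltr_wpDl ?nrm_ge0.
  have d'0 : 0 < d' by rewrite !divr_gt0.
  have dsq : 0 < (d / 2) ^+ 2 / (re x x + 1).
    by rewrite divr_gt0 ?exprn_gt0 ?divr_gt0// ltr_wpDl ?re_ge0.
  have /ltr_add_invr[N] := dsq; rewrite add0r => Ne.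
  have [M _ MP] := kw _ d'0.
  pose n := maxn N M.
  have -> : v = (e - k n) - (w - k n) by rewrite /v opprB addrA subrK.
  rewrite reDl reNl (le_trans (ler_normB _ _))// (splitr d) lerD//.
    rewrite -ler_sqr ?nnegrE ?divr_ge0 ?(ltW d0)// real_normK ?num_real//.
    apply: le_trans (k_orth n x x_0) _.
    have : n.+1%:R^-1 <= N.+1%:R^-1 :> R.
      by rewrite lef_pV2 ?posrE// ler_nat ltnS leq_maxl.
    move=> /le_lt_trans/(_ Ne)/ltW; rewrite ler_pdivlMr; last first.
      by rewrite ltr_wpDl ?re_ge0.
    apply: le_trans; rewrite mulrC ler_wpM2l ?invr_ge0//.
    by rewrite lerDl.
  apply: le_trans (re_le _ _) _.
  apply: (@le_trans _ _ (d' * nrm x)).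
    by rewrite ler_wpM2r ?nrm_ge0// ltW// MP//= leq_maxr.
  by rewrite /d' -mulrA ger_pMr ?divr_gt0// mulrC ler_pdivrMr// mul1r lerDl.
have psiv : psi v = 1 by rewrite psiD psiN psiw subr0.
have v0 : re v v != 0.
  apply/eqP; rewrite re_nrm => /eqP; rewrite sqrf_eq0 => /eqP/nrm_eq0 v0.
  by move: psiv; rewrite v0 psi_0 => /esym/eqP; rewrite oner_eq0.
exists ((re v v)^-1%:C *: v) => x.
have := v_orth (x - (psi x)%:C *: v).
rewrite psiD psiN psiZ psiv mulr1 subrr => /(_ erefl).
rewrite reDr reNr reZr => /subr0_eq vx.
by rewrite reZl vx mulrCA mulVf// mulr1.
Qed.

End HilbertSpace.

(** * Bounded operators and the weak operator topology *)

Lemma cvg_initialP (S : choiceType) (T : topologicalType) (f : S -> T)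
    (F : set_system S) (FF : Filter F) (s : S) :
  F --> (s : initial_topology f) <-> f @ F --> f s.
Proof.
split=> [Fs|Fs A [_ [[B oB <-] Bs] BA]].
  by move=> A /(@initial_continuous _ _ f s)/Fs.
rewrite nbhs_filterE; apply: filterS BA _; apply: Fs.
exact: open_nbhs_nbhs.
Qed.

Lemma Re_le_norm {R : realType} (a : R[i]) : `|Re a| <= Re `|a|.
Proof. by rewrite -lecR RRe_real ?normr_real// normc_ge_Re. Qed.

Lemma norm_le_ReIm {R : realType} (a : R[i]) : Re `|a| <= `|Re a| + `|Im a|.
Proof.
rewrite normc_def /= -[leRHS]ger0_norm ?addr_ge0// -sqrtr_sqr ler_wsqrtr//.
by rewrite sqrrD !real_normK ?num_real// addrAC lerDl mulrn_wge0// mulr_ge0.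
Qed.

Lemma cvg_complexP {R : realType} (T : Type) (F : set_system T) (FF : Filter F)
    (f : T -> R[i]^o) (z : R[i]^o) :
  f @ F --> z <->
  (Re (f t) @[t --> F] --> Re z) /\ (Im (f t) @[t --> F] --> Im z).
Proof.
have Im_le (a : R[i]) : `|Im a| <= Re `|a|.
  case: a => a b; rewrite normc_def /= -sqrtr_sqr ler_wsqrtr//.
  by rewrite lerDr sqr_ge0.
have ImD (a b : R[i]) : Im (a - b) = Im a - Im b by case: a b => ? ? [].
split=> [/cvgrPdist_lt fz|[/cvgrPdist_lt fz1 /cvgrPdist_lt fz2]].
  split; apply/cvgrPdist_lt => e e0; have := fz e%:C; rewrite ltcR => /(_ e0).
    apply: filterS => t; rewrite ltcE /= => /andP[_]; apply: le_lt_trans.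
    by rewrite -ReN -ReD Re_le_norm.
  apply: filterS => t; rewrite ltcE /= => /andP[_]; apply: le_lt_trans.
  by rewrite -ImD.
apply/cvgrPdist_lt => e; rewrite ltcE /= => /andP[/eqP e0 Re0].
have e20 : 0 < Re e / 2 by rewrite divr_gt0.
near=> t; rewrite ltcE (ger0_Im (normr_ge0 _)) e0 eqxx /=.
apply: le_lt_trans (norm_le_ReIm _) _; rewrite (splitr (Re e)) ltrD//.
  by rewrite ReD ReN; near: t; exact: fz1.
by rewrite ImD; near: t; exact: fz2.
Unshelve. all: by end_near. Qed.

Section Operators.
Context {R : realType} (H : hilbertType R).
Implicit Types (x y z : H) (S T : bop H).

Lemma reZ (a : R[i]) x y : re (a *: x) y = re x (a^*%C *: y).
Proof. by rewrite /re linearZl_LR linearZr_LR /= -/(conjc _) /Num.conj /= conjcK. Qed.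

Definition bounded_by (r : R) T := forall x, nrm (T x) <= r * nrm x.

Lemma opnorm_bounded_by T : opnorm T <= 1 <-> bounded_by 1 T.
Proof.
split=> [T1 x|T1].
  by rewrite mul1r -lecR -!nrmE; exact: opnorm_le1.
apply: ge_sup; first by exists (Re `|T 0|); exists 0; rewrite //= normr0.
move=> _ [x + <-] /= => x1; have {}x1 : nrm x <= 1 by rewrite -lecR -nrmE.
by rewrite (le_trans (T1 x))// mul1r.
Qed.

Lemma bounded_byD r s S T :
  bounded_by r S -> bounded_by s T -> bounded_by (r + s) (S + T).
Proof.
move=> Sr Ts x; rewrite mulrDl (le_trans (nrmD _ _))//.
by rewrite lerD ?Sr ?Ts.
Qed.

Lemma bounded_byZ r (t : R) T :
  bounded_by r T -> bounded_by (`|t| * r) (t%:C *: T).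
Proof. by move=> Tr x; rewrite nrmZ -mulrA ler_wpM2l ?Tr. Qed.

Lemma bounded_byM r s S T :
  0 <= r -> bounded_by r S -> bounded_by s T -> bounded_by (r * s) (S * T).
Proof.
by move=> r0 Sr Ts x; rewrite (le_trans (Sr _))// -mulrA ler_wpM2l.
Qed.

Lemma bounded_by1 : bounded_by 1 (1 : bop H).
Proof. by move=> x; rewrite mul1r. Qed.

Lemma bounded_by_ex T : exists2 r : R, 0 < r & bounded_by r T.
Proof.
have /linear_bounded_continuous/linear_boundedP/pinfty_ex_gt0[r r0 Tr] :=
  @bop_continuous R H T.
have rE : r = (Re r)%:C by rewrite RRe_real// gtr0_real.
exists (Re r) => [|x]; first by move: r0; rewrite rE ltcR.
by have := Tr x; rewrite !nrmE rE -rmorphM lecR.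
Qed.

Lemma bop_of_bounded (f : H -> H) (r : R) : linear f ->
  (forall x, nrm (f x) <= r * nrm x) -> {T : bop H | T =1 f}.
Proof.
move=> lf fr; pose lfM := GRing.isLinear.Build R[i] H H *:%R f lf.
pose g : {linear H -> H} := HB.pack f lfM.
suff fP : f \in @bounded_operator R H by exists (Bop fP).
apply/asboolP; split=> //.
apply: (proj1 (linear_bounded_continuous g)); apply/linear_boundedP.
exists (r%:C); split=> [|s rs x]; first by rewrite complex_real.
rewrite (@le_trans _ _ (r%:C * `|x|))//.
  by rewrite !nrmE -rmorphM lecR; exact: fr.
by rewrite ler_wpM2r// ltW.
Qed.

(** Bounded sesquilinear forms are represented by operators. Only the real part
    L of the form is given; the second hypothesis on L says that it comes from a
    complex sesquilinear form. *)
Lemma bop_of_form (L : H -> H -> R) (c : R) : 0 <= c ->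
  (forall x x' y, L (x + x') y = L x y + L x' y) ->
  (forall a x y, L (a *: x) y = L x (a^*%C *: y)) ->
  (forall x y y', L x (y + y') = L x y + L x y') ->
  (forall (t : R) x y, L x (t%:C *: y) = t * L x y) ->
  (forall x y, `|L x y| <= c * (nrm x * nrm y)) ->
  exists2 T : bop H, bounded_by c T & forall x y, re (T x) y = L x y.
Proof.
move=> c0 LDl LZ LDr LZr Lc.
have /choice[f fL] x : exists z, forall y, L x y = re z y.
  have [y|z zL] := @riesz R H (L x) (c * nrm x) (LDr x) (fun t => LZr t x).
    by rewrite -mulrA Lc.
  by exists z => y; rewrite zL reC.
have f_bound x : nrm (f x) <= c * nrm x.
  have [f0|f0] := eqVneq (nrm (f x)) 0.
    by rewrite f0 mulr_ge0// nrm_ge0.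
  rewrite -(ler_pM2r (x := nrm (f x))) ?lt_def ?f0 ?nrm_ge0//.
  by rewrite -expr2 -re_nrm -fL -mulrA (le_trans (ler_norm _))// Lc.
have lf : linear f.
  move=> a x y; apply: re_inj => w.
  by rewrite -fL LDl LZ !fL reDl reZ.
have [T Tf] := bop_of_bounded lf f_bound.
by exists T => [x|x y]; rewrite Tf.
Qed.

Lemma is_adjointP T S :
  is_adjoint T S <-> forall x y, re (T x) y = re x (S y).
Proof.
split=> TS x y; first by rewrite /re TS.
apply/eqP; rewrite eq_complex !Im_inner -/(re _ _) -/(re x _) TS.
by rewrite TS linearZ !eqxx.
Qed.

(** The adjoint represents the form <x, T y>. *)
Lemma adjoint_ex T : exists S, is_adjoint T S.
Proof.
have [r r0 Tr] := bounded_by_ex T.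
have [||||||S _ ST] := @bop_of_form (fun x y => re x (T y)) r.
- exact: ltW.
- by move=> x x' y; rewrite reDl.
- by move=> a x y; rewrite reZ linearZ.
- by move=> x y y'; rewrite linearD reDr.
- by move=> t x y; rewrite linearZ reZr.
- move=> x y; rewrite (le_trans (re_le _ _))// mulrCA ler_wpM2l ?nrm_ge0//.
exists S; apply/is_adjointP => x y.
by rewrite reC -ST reC.
Qed.

Lemma adjoint_bounded_by r T S :
  0 <= r -> is_adjoint T S -> bounded_by r T -> bounded_by r S.
Proof.
move=> r0 /is_adjointP TS Tr x.
have [S0|S0] := eqVneq (nrm (S x)) 0; first by rewrite S0 mulr_ge0// nrm_ge0.
rewrite -(ler_pM2r (x := nrm (S x))) ?lt_def ?S0 ?nrm_ge0//.
rewrite -expr2 -re_nrm -TS (le_trans (ler_norm _))// (le_trans (re_le _ _))//.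
by rewrite mulrAC ler_wpM2r ?nrm_ge0.
Qed.

Lemma is_adjointC T S : is_adjoint T S -> is_adjoint S T.
Proof. by move/is_adjointP => TS; apply/is_adjointP => x y; rewrite reC -TS reC. Qed.

Lemma is_adjoint_uniq T S S' : is_adjoint T S -> is_adjoint T S' -> S = S'.
Proof.
move=> /is_adjointP TS /is_adjointP TS'; apply/val_inj/funext => x.
by apply: re_inj => w; rewrite reC -TS TS' reC.
Qed.

Lemma bop_eqP S T : (forall x y, re (S x) y = re (T x) y) -> S = T.
Proof. by move=> ST; apply/val_inj/funext => x; apply: re_inj => w; exact: ST. Qed.

Lemma wot_cvgP (F : set_system (bop H)) (FF : Filter F) T :
  F --> (T : wot H) <-> forall x y, (fun S : bop H => re (S x) y) @ F --> re (T x) y.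
Proof.
rewrite cvg_initialP; split=> [FT x y|FT].
  have := proj1 (@ptws_cvgP _ _ (@wot_form R H @ F) _ _) FT.
  by move=> /(_ _ (x, y))/cvg_complexP[].
apply/(@ptws_cvgP _ _ (@wot_form R H @ F) _) => -[x y].
apply/cvg_complexP; split; first exact: FT.
rewrite /= /wot_form /= Im_inner.
have := FT x ('i%C *: y).
rewrite (_ : (fun S => _) = (fun S : bop H => Im (inner (S x) y)))//.
by apply/funext => S; rewrite Im_inner.
Qed.

End Operators.

(** * Weak compactness of the unit ball *)

Lemma ultra_fmap (T U : Type) (f : T -> U) (F : set_system T) :
  UltraFilter F -> UltraFilter (f @ F).
Proof.
move=> FU; split=> [|G FG FfG]; first exact: fmap_proper_filter.
apply/seteqP; split=> A; last exact: FfG.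
move=> GA; have [//|FAc] := in_ultra_setVsetC (f @^-1` A) FU.
have /FfG GAc : (f @ F) (~` A) by [].
have [x [Ax]] := filter_ex (filterI GA GAc).
exact.
Qed.

Lemma ultra_bounded_cvg {R : realType} (T : Type) (F : set_system T)
    (f : T -> R) (c : R) :
  UltraFilter F -> F [set t | `|f t| <= c] -> cvg (f @ F).
Proof.
move=> FU Fc; have := @segment_compact R (- c) c; rewrite compact_ultra.
move=> /(_ (f @ F) (ultra_fmap _ FU)) [|l [_ Fl]]; last exact: cvgP Fl.
by rewrite /= /fmap /=; apply: filterS Fc => t; rewrite /= in_itv /= ler_norml.
Qed.

Section WeakBall.
Context {R : realType} (H : hilbertType R).
Implicit Types (x y z : H) (S T : bop H).

Lemma cvg_ler_norm (I : Type) (F : set_system I) (FF : ProperFilter F)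
    (f : I -> R) (l c : R) : f @ F --> l -> F [set t | `|f t| <= c] -> `|l| <= c.
Proof.
move=> fl Fc; apply: (@closed_cvg _ _ F FF f [set u : R | `|u| <= c]) fl.
  rewrite (_ : mkset _ = [set u | - c <= u] `&` [set u | u <= c]).
    by apply: closedI; [exact: closed_ge|exact: closed_le].
  apply/seteqP; split=> u /=; first by rewrite ler_norml => /andP.
  by move=> [cu uc]; rewrite ler_norml cu.
exact: Fc.
Qed.

(** Along an ultrafilter every bounded matrix coefficient converges, and the
    limits of the coefficients form a bounded sesquilinear form. *)
Lemma ultra_wot_limit (F : set_system (bop H)) (FU : UltraFilter F) (r : R) :
  0 <= r -> F (bounded_by r) -> exists2 T : bop H, bounded_by r T &
    forall x y, (fun S : bop H => re (S x) y) @ F --> re (T x) y.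
Proof.
move=> r0 Fr.
have bd x y : F [set S : bop H | `|re (S x) y| <= r * (nrm x * nrm y)].
  apply: filterS Fr => S Sr /=; rewrite (le_trans (re_le _ _))// mulrA.
  by rewrite ler_wpM2r ?nrm_ge0.
pose L x y : R := lim ((fun S : bop H => re (S x) y) @ F).
have FL x y : (fun S : bop H => re (S x) y) @ F --> L x y.
  exact: ultra_bounded_cvg (bd x y).
have Luniq x y l : (fun S : bop H => re (S x) y) @ F --> l -> L x y = l.
  exact: (cvg_unique (@norm_hausdorff _ _) (FL x y)).
have [|||||T Tr TL] := @bop_of_form R H L r r0.
- move=> x x' y; apply: Luniq.
  rewrite (_ : (fun S => _) =
      (fun S : bop H => re (S x) y) \+ (fun S : bop H => re (S x') y)).
    exact: cvgD (FL x y) (FL x' y).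
  by apply/funext => S; rewrite linearD reDl.
- move=> a x y; apply: Luniq.
  rewrite (_ : (fun S => _) = (fun S : bop H => re (S x) (a^*%C *: y))) //.
  by apply/funext => S; rewrite linearZ reZ.
- move=> x y y'; apply: Luniq.
  rewrite (_ : (fun S => _) =
      (fun S : bop H => re (S x) y) \+ (fun S : bop H => re (S x) y')).
    exact: cvgD (FL x y) (FL x y').
  by apply/funext => S; rewrite reDr.
- move=> t x y; apply: Luniq.
  rewrite (_ : (fun S => _) = (fun S : bop H => t * re (S x) y)).
    exact: cvgMr (FL x y).
  by apply/funext => S; rewrite reZr.
- by move=> x y; exact: cvg_ler_norm (FL x y) (bd x y).
by exists T => // x y; rewrite TL.
Qed.

Definition to_ball (M : set (bop H)) T (MT : M T) (T1 : bounded_by 1 T) :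
  weak_ball M := exist _ T (mem_set (conj MT (proj2 (opnorm_bounded_by T) T1))).

Lemma weak_ball_mem (M : set (bop H)) (t : weak_ball M) : M (set_val t).
Proof. by have [] := set_valP t. Qed.

Lemma weak_ball_le1 (M : set (bop H)) (t : weak_ball M) :
  bounded_by 1 (set_val t).
Proof. by have [_ /opnorm_bounded_by] := set_valP t. Qed.

Lemma weak_ball_cvgP (M : set (bop H)) (F : set_system (weak_ball M))
    (FF : Filter F) (t : weak_ball M) :
  F --> t <-> forall x y,
    (fun s : weak_ball M => re (set_val s x) y) @ F --> re (set_val t x) y.
Proof. by rewrite cvg_initialP (wot_cvgP (F := set_val @ F)). Qed.

Lemma continuous_weak_ball (Y : topologicalType) (M : set (bop H))
    (f : Y -> weak_ball M) :
  (forall x y, continuous (fun u => re (set_val (f u) x) y)) -> continuous f.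
Proof.
move=> fc u; apply/(weak_ball_cvgP (F := f @ u)) => x y.
exact: fc.
Qed.

Lemma weak_ball_re_continuous (M : set (bop H)) x y :
  continuous (fun t : weak_ball M => re (set_val t x) y).
Proof.
move=> t; have FF := nbhs_filter t.
by apply: (proj1 (@weak_ball_cvgP M (nbhs t) _ t)).
Qed.

Lemma weak_ball_hausdorff (M : set (bop H)) : hausdorff_space (weak_ball M).
Proof.
move=> s t st; apply/val_inj/bop_eqP => x y.
apply: (@norm_hausdorff _ R^o) => A B As Bt.
have [u [Au Bu]] := st _ _ (weak_ball_re_continuous (x := x) (y := y) As)
  (weak_ball_re_continuous (x := x) (y := y) Bt).
by exists (re (set_val u x) y).
Qed.

(** An ultrafilter on the ball of M has a weak limit T of norm at most 1. It
    converges to T also ultraweakly, as the two topologies agree on the ball of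
    all bounded operators; so T is in M. *)
Lemma weak_ball_compact (M : set (bop H)) :
  closed (M : set (ultraweak H)) -> compact [set: weak_ball M].
Proof.
move=> cM; rewrite compact_ultra => F FU _.
have FvU : UltraFilter (set_val @ F : set_system (bop H)) by exact: ultra_fmap.
have [||T T1 FT] := @ultra_wot_limit (set_val @ F) FvU 1.
- exact: ler01.
- by apply: (@filterE _ F) => s; exact: (@weak_ball_le1 M s).
pose j (s : weak_ball M) : weak_ball [set: bop H] :=
  @to_ball setT (set_val s) Logic.I (weak_ball_le1 s).
have jT : j @ F --> @to_ball setT T Logic.I T1.
  by apply/(weak_ball_cvgP (F := j @ F)).
have FjT : (set_val \o j : weak_ball M -> ultraweak H) @ F --> (T : ultraweak H).
  by move=> A /(@ultraweak_continuous R H setT (@to_ball setT T Logic.I T1))/jT.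
have MT : M T.
  apply: (closed_cvg (F := F) _ cM _ _ FjT).
  by apply: nearW => s; exact: (@weak_ball_mem M s).
by exists (to_ball MT T1); split=> //; apply/weak_ball_cvgP.
Qed.

End WeakBall.

(** * A Kaplansky density theorem *)

Lemma cvg_geometric_bound {R : realType} (f : nat -> R) (K q : R) : 0 <= q -> q < 1 ->
  (forall n, `|f n| <= K * q ^+ n) -> f @ \oo --> 0.
Proof.
move=> q0 q1 fK; apply/cvgrPdist_lt => e e0.
have /cvgrPdist_lt/(_ _ e0) : (fun n => K * q ^+ n) @ \oo --> K * 0.
  by apply: cvgMr; apply: cvg_expr; rewrite ger0_norm.
apply: filterS => n; rewrite mulr0 !sub0r !normrN; apply: le_lt_trans.
exact: le_trans (fK n) (ler_norm _).
Qed.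

Lemma near_seq (T : eqType) (s : seq T) (F : set_system nat) (FF : Filter F)
    (P : T -> nat -> Prop) :
  (forall t, t \in s -> \forall n \near F, P t n) ->
  \forall n \near F, forall t, t \in s -> P t n.
Proof.
elim: s => [|t s IHs] tP; first by apply: nearW => n t.
have tn := tP t (mem_head _ _).
have sn : \forall n \near F, forall t', t' \in s -> P t' n.
  by apply: IHs => t' t's; apply: tP; rewrite inE t's orbT.
by apply: filterS2 tn sn => n tn sn t'; rewrite inE => /predU1P[->|/sn].
Qed.

(** Stated for a sequence of indices because the hypothesis is available only
    for its members. *)
Lemma cvg_sum_seq {R : realType} (T : eqType) (s : seq T) (f : T -> nat -> R)
    (l : T -> R) :
  (forall t, t \in s -> f t @ \oo --> l t) ->
  (fun n => \sum_(t <- s) f t n) @ \oo --> \sum_(t <- s) l t.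
Proof.
elim: s => [|t s IHs] fl.
  rewrite big_nil (_ : (fun n => _) = fun=> 0); first exact: cvg_cst.
  by apply/funext => n; rewrite big_nil.
rewrite big_cons (_ : (fun n => _) = f t \+ (fun n => \sum_(t <- s) f t n)).
  apply: cvgD; first by apply: fl; exact: mem_head.
  by apply: IHs => t' t's; apply: fl; rewrite inE t's orbT.
by apply/funext => n; rewrite big_cons.
Qed.

Section Kaplansky.
Context {R : realType} (H : hilbertType R).
Implicit Types (x y z a b : H) (S T A : bop H).

Lemma scale_bopE (c : R[i]) T x : (c *: T) x = c *: T x. Proof. by []. Qed.
Lemma add_bopE S T x : (S + T) x = S x + T x. Proof. by []. Qed.
Lemma opp_bopE T x : (- T) x = - T x. Proof. by []. Qed.
Lemma mul_bopE S T x : (S * T) x = S (T x). Proof. by []. Qed.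
Lemma one_bopE x : (1 : bop H) x = x. Proof. by []. Qed.
Definition bopE := (scale_bopE, add_bopE, opp_bopE, mul_bopE, one_bopE).

Lemma bopD T x y : T (x + y) = T x + T y. Proof. exact: linearD. Qed.
Lemma bopB T x y : T (x - y) = T x - T y. Proof. exact: linearB. Qed.
Lemma bopZ T (c : R[i]) x : T (c *: x) = c *: T x. Proof. exact: linearZ. Qed.

(** N is a unital *-algebra of operators whose unit ball is weakly compact. *)
Variable N : set (bop H).
Hypotheses (N1 : N 1) (N_lin : forall c S T, N S -> N T -> N (c *: S + T))
  (N_mul : forall S T, N S -> N T -> N (S * T))
  (N_adj : forall T, N T -> exists2 S, N S & is_adjoint T S).
Hypothesis ball_compact : forall F : set_system (bop H), UltraFilter F ->
  F [set S | N S /\ bounded_by 1 S] -> exists T,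
    [/\ N T, bounded_by 1 T &
        forall x y, (fun S : bop H => re (S x) y) @ F --> re (T x) y].

Lemma lin_closed0 : N 0.
Proof. by have := N_lin (-1) N1 N1; rewrite scaleN1r addNr. Qed.

Lemma lin_closedZ (c : R[i]) T : N T -> N (c *: T).
Proof. by move=> NT; have := N_lin c NT lin_closed0; rewrite addr0. Qed.

Lemma lin_closedD S T : N S -> N T -> N (S + T).
Proof. by move=> NS NT; have := N_lin 1 NS NT; rewrite scale1r. Qed.

Lemma ball_ultra_limit (r : R) (F : set_system (bop H)) : 0 < r -> UltraFilter F ->
  F [set S | N S /\ bounded_by r S] -> exists T,
    [/\ N T, bounded_by r T &
        forall x y, (fun S : bop H => re (S x) y) @ F --> re (T x) y].
Proof.
move=> r0 FU FN; pose f S : bop H := r^-1%:C *: S.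
have [||T [NT T1 FT]] := ball_compact (F := f @ F); first exact: ultra_fmap.
  rewrite /= /fmap /=; apply: filterS FN => S [NS Sr]; split; first exact: lin_closedZ.
  have := bounded_byZ r^-1 Sr.
  by rewrite ger0_norm ?invr_ge0 ?(ltW r0)// mulVf// gt_eqF.
exists (r%:C *: T); split=> [||x y].
- exact: lin_closedZ.
- by have := bounded_byZ r T1; rewrite gtr0_norm// mulr1.
rewrite bopE reZl.
rewrite (_ : (fun S => _) = (fun S : bop H => r * re (f S x) y)).
  exact: cvgMr (FT x y).
by apply/funext => S; rewrite /f bopE reZl mulrA mulfV ?gt_eqF// mul1r.
Qed.

(** A bounded sequence of N has a weak cluster point in N, at which every
    convergent matrix coefficient takes its limit. *)
Lemma ball_seq_limit (r : R) (u : nat -> bop H) : 0 < r ->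
  (forall n, N (u n)) -> (forall n, bounded_by r (u n)) ->
  exists2 T, N T & bounded_by r T /\ forall x y (l : R),
    (fun n => re (u n x) y) @ \oo --> l -> re (T x) y = l.
Proof.
move=> r0 Nu ur; have [G [GU ooG]] := @ultraFilterLemma _ (\oo : set_system nat) _.
have [||T [NT Tr GT]] := @ball_ultra_limit r (u @ G) r0; first exact: ultra_fmap.
  by rewrite /= /fmap /=; apply: filterE.
exists T => //; split=> // x y l ul.
apply: (cvg_unique (@norm_hausdorff _ R^o) (GT x y)).
by move=> B /ul/ooG.
Qed.

(** With c = 1/(1 + r^2), the positive operator c(1 + S^2) lies between c and 1,
    so 1 - c(1 + S^2) has norm at most 1 - c. The choice of c makes c r^2 = 1 -
    c. *)
Lemma contraction_step (r c : R) S : 0 < r -> bounded_by r S ->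
  is_adjoint S S -> c = (1 + r ^+ 2)^-1 ->
  forall a, nrm (a - c%:C *: (a + S (S a))) <= (1 - c) * nrm a.
Proof.
move=> r0 Sr /is_adjointP SS cE a.
have r1 : 0 < 1 + r ^+ 2 by rewrite ltr_pwDl// exprn_ge0 ?ltW.
have c0 : 0 < c by rewrite cE invr_gt0.
have cr : c * r ^+ 2 = 1 - c.
  by rewrite cE; field; rewrite gt_eqF.
have c1 : 0 <= 1 - c by rewrite -cr mulr_ge0 ?exprn_ge0 ?ltW.
rewrite -ler_sqr ?nnegrE ?mulr_ge0 ?nrm_ge0// exprMn -!re_nrm.
have -> : a - c%:C *: (a + S (S a)) = (1 - c)%:C *: a - c%:C *: S (S a).
  by rewrite scalerDr opprD addrA rmorphB /= scalerBl scale1r.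
rewrite reDl reNl !reZl !(reC _ (_ - _)) !reDl !reNl !reZl.
rewrite (reC a) (SS (S a) a) !re_nrm.
have : nrm (S (S a)) ^+ 2 <= r ^+ 2 * nrm (S a) ^+ 2.
  by rewrite -exprMn ler_sqr ?nnegrE ?mulr_ge0 ?nrm_ge0 ?(ltW r0)// Sr.
have := sqr_ge0 (nrm (S a)).
move: (nrm (S (S a)) ^+ 2) (nrm (S a) ^+ 2) (nrm a ^+ 2) => u v w v0 uv.
have : c * u <= c * (r ^+ 2 * v) by rewrite ler_wpM2l// ltW.
rewrite mulrA cr => cu.
have : c * (c * u) <= c * ((1 - c) * v) by rewrite ler_wpM2l// ltW.
have : 0 <= c * (1 - c) * v by rewrite !mulr_ge0// ltW.
nra.
Qed.

(** Pairing with z gives nrm z ^ 2 + nrm (S z) ^ 2 = 2 re a z. *)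
Lemma resolvent_bound S z a : is_adjoint S S ->
  z + S (S z) = 2%:C *: a -> nrm z <= 2 * nrm a.
Proof.
move=> /is_adjointP SS zE.
have [z0|z0] := eqVneq (nrm z) 0; first by rewrite z0 mulr_ge0// nrm_ge0.
rewrite -(ler_pM2r (x := nrm z)) ?lt_def ?z0 ?nrm_ge0//.
have : re (z + S (S z)) z = 2 * re a z by rewrite zE reZl.
rewrite reDl SS !re_nrm => e.
have := ler_norm (re a z); have := re_le a z; have := sqr_ge0 (nrm (S z)).
by rewrite -expr2; nra.
Qed.

(** Pairing with z gives nrm z ^ 2 + nrm (S z) ^ 2 = 2 re a (S z), and the right
    side is at most nrm a ^ 2 + nrm (S z) ^ 2. *)
Lemma bounded_transform_le1 S z a : is_adjoint S S ->
  z + S (S z) = 2%:C *: S a -> nrm z <= nrm a.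
Proof.
move=> /is_adjointP SS zE; rewrite -ler_sqr ?nnegrE ?nrm_ge0// -!re_nrm.
have : re (z + S (S z)) z = 2 * re a (S z) by rewrite zE reZl SS.
rewrite reDl SS => e.
have := re_ge0 (a - S z); rewrite reDl !reDr !reNl !reNr (reC (S z) a).
by move: e; lra.
Qed.

(** Z is 2S(1 + S^2)^-1, obtained inside N as a weak limit of the Richardson
    iteration u(n+1) = u(n) + c E(u n), where E(T) = 2S - T(1 + S^2) is the
    residual. The residual is multiplied by an operator of norm less than 1 at
    each step, so it tends to 0 geometrically and the iterates stay bounded. The
    second bound holds because 2 - ZS = 2(1 + S^2)^-1. *)
Lemma bounded_transform (S : bop H) : N S -> is_adjoint S S ->
  exists2 Z, N Z & [/\ bounded_by 1 Z, forall a, nrm (Z (S a)) <= 4 * nrm a &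
    forall a, Z (a + S (S a)) = 2%:C *: S a].
Proof.
move=> NS sS; have [r r0 Sr] := bounded_by_ex S.
have /is_adjointP SS := sS.
pose c := (1 + r ^+ 2)^-1; have cE : c = (1 + r ^+ 2)^-1 by [].
have contr := contraction_step r0 Sr sS cE.
have r1 : 0 < 1 + r ^+ 2 by rewrite ltr_pwDl// exprn_ge0 ?ltW.
have c0 : 0 < c by rewrite invr_gt0.
have c1 : c < 1 by rewrite invf_lt1// ltrDl exprn_gt0.
pose P : bop H := 1 + S * S.
pose E (T : bop H) : bop H := 2%:C *: S - T * P.
pose u := fix u n : bop H := if n is m.+1 then u m + c%:C *: E (u m) else 0.
have PE a : P a = a + S (S a) by [].
have EE T a : E T a = 2%:C *: S a - T (P a) by [].
have uS n a : u n.+1 a = u n a + c%:C *: E (u n) a by [].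
have NP : N P by apply: lin_closedD => //; exact: N_mul.
have NE T : N T -> N (E T).
  move=> NT; rewrite /E -scaleN1r; apply: lin_closedD; first exact: lin_closedZ.
  by apply: lin_closedZ; exact: N_mul.
have Nu n : N (u n).
  elim: n => [|n IHn] /=; first exact: lin_closed0.
  by apply: lin_closedD => //; apply: lin_closedZ; exact: NE.
have uC n a : S (u n a) = u n (S a).
  elim: n a => [|n IHn] a; first exact: linear0.
  by rewrite !uS !EE bopD bopZ bopB bopZ !IHn !PE !bopD.
have ES n a : E (u n.+1) a = E (u n) (a - c%:C *: P a).
  by rewrite bopB bopZ EE uS opprD addrA -EE.
have E_le n a : nrm (E (u n) a) <= 2 * r * (1 - c) ^+ n * nrm a.
  elim: n a => [|n IHn] a.
    rewrite EE (_ : u 0%N (P a) = 0)// subr0 nrmZ ger0_norm// expr0 mulr1.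
    by rewrite -mulrA ler_wpM2l.
  rewrite ES exprSr mulrA -[leRHS]mulrA; apply: le_trans (IHn _) _.
  by rewrite ler_wpM2l ?contr// !mulr_ge0 ?exprn_ge0 ?subr_ge0 ?ltW.
have u_le n a : nrm (u n a) <= 2 * r * (1 - (1 - c) ^+ n) * nrm a.
  elim: n => [|n IHn]; first by rewrite expr0 subrr mulr0 mul0r (_ : u 0%N a = 0)// nrm0.
  rewrite uS; apply: le_trans (nrmD _ _) _; rewrite nrmZ gtr0_norm//.
  have := E_le n a; rewrite -(ler_pM2l c0); move: IHn; rewrite exprSr.
  move: (nrm (u n a)) (nrm (E (u n) a)) (nrm a) ((1 - c) ^+ n) => p q s t.
  nra.
have u_bd n : bounded_by (2 * r) (u n).
  move=> a; apply: le_trans (u_le n a) _; rewrite ler_wpM2r ?nrm_ge0//.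
  rewrite ler_piMr ?mulr_ge0 ?(ltW r0)// lerBlDr lerDl exprn_ge0//.
  by rewrite subr_ge0 ltW.
have r20 : 0 < 2 * r by rewrite mulr_gt0.
have [Z NZ [_ Zlim]] := ball_seq_limit r20 Nu u_bd.
have lim_uP a b : (fun n => re (u n (P a)) b) @ \oo --> re (2%:C *: S a) b.
  rewrite (_ : (fun n => _) =
      (fun n => re (2%:C *: S a) b - re (E (u n) a) b)); last first.
    by apply/funext => n; rewrite EE reDl reNl opprB addrC subrK.
  rewrite -[X in _ --> X]subr0; apply: cvgB; first exact: cvg_cst.
  apply: (@cvg_geometric_bound R _ (2 * r * nrm a * nrm b) (1 - c)) => [||n].
  - by rewrite subr_ge0 ltW.
  - by rewrite ltrBlDr ltrDl.
  - rewrite (le_trans (re_le _ _))// mulrAC ler_wpM2r ?nrm_ge0//.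
    by rewrite (le_trans (E_le _ _))// mulrAC.
have ZP a : Z (P a) = 2%:C *: S a.
  by apply: re_inj => b; apply: Zlim; exact: lim_uP.
have PZ a : P (Z a) = 2%:C *: S a.
  apply: re_inj => b.
  have -> : re (P (Z a)) b = re (Z a) (P b).
    by rewrite !PE reDl reDr SS SS.
  apply: Zlim; have := lim_uP a b.
  rewrite (_ : (fun n => re _ b) = (fun n => re (u n a) (P b)))//.
  by apply/funext => n; rewrite !PE bopD reDl reDr -!SS !uC.
exists Z => //; split=> [a|a|a]; last exact: ZP.
  by rewrite mul1r; exact: bounded_transform_le1 (PZ a).
have w : nrm (2%:C *: a - Z (S a)) <= 2 * nrm a.
  apply: (resolvent_bound sS).
  rewrite !bopB !bopZ addrACA -opprD -PE PZ.
  by rewrite addrK.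
have -> : Z (S a) = 2%:C *: a - (2%:C *: a - Z (S a)) by rewrite subKr.
apply: le_trans (nrmB _ _) _; rewrite nrmZ ger0_norm//.
by move: w; lra.
Qed.

(** By Hahn-Banach this says that A is in the weak operator closure of N; stated
    by annihilating functionals, it passes to adjoints and linear combinations
    without a choice of approximants. *)
Definition weakly_adherent A := forall s : seq (H * H),
  (forall S, N S -> \sum_(p <- s) re (S p.1) p.2 = 0) ->
  \sum_(p <- s) re (A p.1) p.2 = 0.

(** Along a sequence of self-adjoint elements S of N minimizing the sum of the
    squared norms of (A - S)z, z in s, the residuals (A - S)z converge; call w z
    their limits. Minimality says that the sum of re (y z) (w z) is 0 for all
    self-adjoint y in N. For self-adjoint y, this sum is half the value at y of
    the functional given by the pairs (z, w z) and (w z, z); as that functional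
    vanishes on all of N, it vanishes at A. So the w z are orthogonal to the A z
    as well as to the S z, in the sense of these sums, and they are 0. *)
Lemma strongly_adherent A (s : seq H) (d : R) :
  is_adjoint A A -> weakly_adherent A -> 0 < d ->
  exists S, [/\ N S, is_adjoint S S &
    forall z, z \in s -> nrm ((A - S) z) <= d].
Proof.
move=> sA wA d0; have /is_adjointP AA := sA.
pose b S T : R := \sum_(z <- s) re (S z) (T z).
pose K : set (bop H) := [set S | N S /\ is_adjoint S S].
have bC S T : b S T = b T S by apply: eq_bigr => z _; rewrite reC.
have bDl S S' T : b (S + S') T = b S T + b S' T.
  by rewrite -big_split; apply: eq_bigr => z _; rewrite bopE reDl.
have bZl (t : R) S T : b (t%:C *: S) T = t * b S T.
  by rewrite mulr_sumr; apply: eq_bigr => z _; rewrite bopE reZl.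
have b_ge0 S : 0 <= b S S by apply: sumr_ge0 => z _; exact: re_ge0.
have [|||k Kk [k_orth k_cauchy]] := minimizing_sequence bC bDl bZl b_ge0 (K := K) A.
- by split; [exact: lin_closed0|apply/is_adjointP => x y; rewrite !re0l reC re0l].
- move=> S T [NS /is_adjointP SS] [NT /is_adjointP TT].
  split; first exact: lin_closedD.
  by apply/is_adjointP => x y; rewrite !bopE reDl reDr SS TT.
- move=> t S [NS /is_adjointP SS]; split; first exact: lin_closedZ.
  by apply/is_adjointP => x y; rewrite !bopE reZl reZr SS.
have /choice[v kv] z : exists w, z \in s -> forall e : R, 0 < e ->
    \forall n \near \oo, nrm (w - k n z) < e.
  have [zs|_] := boolP (z \in s); last by exists 0.
  have [|w kw] := @nrm_cauchy_sq R H (fun n => k n z); last by exists w.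
  move=> M m n Mm Mn; apply: le_trans (k_cauchy M m n Mm Mn).
  rewrite -re_nrm /b (perm_big _ (perm_to_rem zs)) big_cons lerDl.
  by apply: sumr_ge0 => z' _; exact: re_ge0.
have kv_re z w : z \in s -> (fun n => re (k n z) w) @ \oo --> re (v z) w.
  move=> zs; apply/cvgrPdist_lt => e e0.
  have w1 : 0 < nrm w + 1 by rewrite ltr_wpDl ?nrm_ge0.
  have := kv z zs _ (divr_gt0 e0 w1); apply: filterS => n vn.
  rewrite -reNl -reDl; apply: le_lt_trans (re_le _ _) _.
  apply: (@le_lt_trans _ _ (nrm (v z - k n z) * (nrm w + 1))).
    by rewrite ler_wpM2l ?nrm_ge0// lerDl.
  by rewrite -ltr_pdivlMr.
pose w z := A z - v z.
have w_orth S : K S -> \sum_(z <- s) re (w z) (S z) = 0.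
  move=> KS; have bk : (fun n => b (A - k n) S) @ \oo --> \sum_(z <- s) re (w z) (S z).
    apply: cvg_sum_seq => z zs; rewrite /w reDl reNl.
    rewrite (_ : (fun n => _) = (fun n => re (A z) (S z) - re (k n z) (S z))).
      by apply: cvgB; [exact: cvg_cst|exact: kv_re].
    by apply/funext => n; rewrite !bopE reDl reNl.
  apply: (cvg_unique (@norm_hausdorff _ R^o) bk).
  apply/cvgrPdist_lt => e e0.
  have e20 : 0 < e ^+ 2 / (b S S + 1).
    by rewrite divr_gt0 ?exprn_gt0// ltr_wpDl.
  have /ltr_add_invr[M] := e20; rewrite add0r => Me.
  exists M => // n /= Mn; rewrite sub0r normrN -ltr_sqr ?nnegrE ?(ltW e0)//.
  rewrite real_normK ?num_real//; apply: le_lt_trans (k_orth n S KS) _.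
  have : n.+1%:R^-1 <= M.+1%:R^-1 :> R by rewrite lef_pV2 ?posrE// ler_nat ltnS.
  move=> /le_lt_trans/(_ Me); rewrite ltr_pdivlMr ?ltr_wpDl//.
  apply: le_lt_trans; rewrite mulrC ler_wpM2l ?invr_ge0//.
  by rewrite lerDl.
(* If S' is the adjoint of S in N, the functional given by the pairs (z, w
   z) and (w z, z) maps S to the sum of re (w z) ((S + S') z), which is 0
   because S + S' is self-adjoint. *)
have w_A : \sum_(z <- s) re (w z) (A z) = 0.
  have := wA ([seq (z, w z) | z <- s] ++ [seq (w z, z) | z <- s]).
  rewrite big_cat !big_map /= => /(_ _)/wrap[S NS|].
    have [S' NS' SS'] := N_adj NS; rewrite big_cat !big_map /= -big_split /=.
    have KSS : K (S + S').
      split; first exact: lin_closedD.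
      apply/is_adjointP => x y; rewrite !bopE reDl reDr addrC.
      have /is_adjointP -> := is_adjointC SS'.
      by have /is_adjointP -> := SS'.
    rewrite -[RHS](w_orth _ KSS); apply: eq_bigr => z _.
    rewrite bopE reDr (reC (S z)); congr (_ + _).
    by have /is_adjointP -> := SS'.
  rewrite -big_split /=.
  rewrite (eq_bigr (fun z => 2 * re (w z) (A z))) => [|z _].
    by rewrite -mulr_sumr => /eqP; rewrite mulf_eq0 pnatr_eq0 /= => /eqP.
  by rewrite (AA (w z)) (reC (A z)) mulr2n mulrDl mul1r.
have w_v : \sum_(z <- s) re (w z) (v z) = 0.
  have bk : (fun n => \sum_(z <- s) re (w z) (k n z)) @ \oo -->
      \sum_(z <- s) re (w z) (v z).
    apply: cvg_sum_seq => z zs; rewrite reC.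
    rewrite (_ : (fun n => _) = (fun n => re (k n z) (w z))); first exact: kv_re.
    by apply/funext => n; rewrite reC.
  apply: (cvg_unique (@norm_hausdorff _ R^o) bk).
  rewrite (_ : (fun n => _) = fun=> 0); first exact: cvg_cst.
  by apply/funext => n; exact: w_orth.
have w0 z : z \in s -> A z = v z.
  move=> zs; apply/subr0_eq/nrm_eq0/eqP; rewrite -sqrf_eq0 -re_nrm -/(w z).
  have : \sum_(z <- s) re (w z) (w z) == 0.
    rewrite (eq_bigr (fun z => re (w z) (A z) - re (w z) (v z))) => [|z' _].
      by rewrite sumrB w_A w_v subr0.
    by rewrite {2}/w reDr reNr.
  rewrite psumr_eq0 => [|z' _]; last exact: re_ge0.
  by move=> /allP/(_ z zs).
have [n _ /(_ n (leqnn n)) nP] : \forall n \near \oo, forall z, z \in s ->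
    nrm (v z - k n z) < d.
  by apply: near_seq => z zs; exact: kv.
exists (k n); have [Nk sk] := Kk n; split=> // z zs.
by rewrite !bopE w0// ltW// nP.
Qed.

(** If x in N is self-adjoint and close to A on z and on A z, its bounded
    transform Z satisfies Z(1 + A^2)z - 2Az = Zx(A - x)z + Z(A - x)Az - 2(A -
    x)z, which is small because Z and Zx are bounded independently of x. These Z
    lie in the compact ball of N; a cluster point satisfies the identity for all
    z. *)
Lemma bounded_transform_adherent A : is_adjoint A A -> weakly_adherent A ->
  exists2 Z, N Z & bounded_by 1 Z /\ forall a, Z (a + A (A a)) = 2%:C *: A a.
Proof.
move=> sA wA.
pose gap Z z := nrm (Z (z + A (A z)) - 2%:C *: A z).
pose D (i : seq H * R) : set (bop H) :=
  [set Z | [/\ N Z, bounded_by 1 Z & forall z, z \in i.1 -> gap Z z <= i.2]].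
pose F := filter_from [set i : seq H * R | 0 < i.2] D.
have D_ne i : 0 < i.2 -> D i !=set0.
  (* The three error terms have norm at most 4, 1 and 2 times the precision. *)
  case: i => s d /= d0; have d70 : 0 < d / 7 by rewrite divr_gt0.
  have [S [NS sS AS]] := strongly_adherent (s ++ [seq A z | z <- s]) sA wA d70.
  have [Z NZ [Z1 ZS ZE]] := bounded_transform NS sS.
  exists Z; split=> // z zs; rewrite /gap.
  have Az : nrm ((A - S) z) <= d / 7 by apply: AS; rewrite mem_cat zs.
  have AAz : nrm ((A - S) (A z)) <= d / 7.
    by apply: AS; rewrite mem_cat (map_f A zs) orbT.
  have -> : Z (z + A (A z)) - 2%:C *: A z =
      Z (S ((A - S) z)) + Z ((A - S) (A z)) - 2%:C *: (A - S) z.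
    have -> : z + A (A z) =
        (z + S (S z)) + (S ((A - S) z) + (A - S) (A z)).
      rewrite !bopE bopB -[RHS]addrA; congr (_ + _).
      by rewrite addrA [S (S z) + _]addrC subrK addrC subrK.
    rewrite bopD ZE bopD [(A - S) z in X in _ = _ - X]bopE scalerBr opprB.
    by rewrite [2%:C *: S z + _]addrC -addrA.
  apply: le_trans (nrmB _ _) _; rewrite nrmZ ger0_norm//.
  have := nrmD (Z (S ((A - S) z))) (Z ((A - S) (A z))).
  have := ZS ((A - S) z); have := Z1 ((A - S) (A z)).
  by rewrite -[(s, d).2]/d; move: Az AAz; lra.
have FF : ProperFilter F.
  apply: filter_from_proper => [|i i0]; last exact: D_ne.
  apply: filter_from_filter; first by exists ([::], 1) => /=.
  move=> [s d] [t e] /= d0 e0; exists (s ++ t, Num.min d e).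
    by rewrite /= lt_min d0.
  move=> Z [NZ Z1 /= Zst]; split; split=> // z /= zs.
    by have := Zst z; rewrite mem_cat zs => /(_ isT); rewrite le_min => /andP[].
  by have := Zst z; rewrite mem_cat zs orbT => /(_ isT); rewrite le_min => /andP[].
have [G [GU FG]] := ultraFilterLemma FF.
have [|Z [NZ Z1 GZ]] := ball_compact GU.
  by apply: FG; exists ([::], 1) => //= S [NS S1 _].
exists Z => //; split=> // a; apply: re_inj => b.
apply: (cvg_unique (@norm_hausdorff _ R^o) (GZ _ b)).
apply/cvgrPdist_lt => e e0; apply: FG.
have b1 : 0 < nrm b + 1 by rewrite ltr_wpDl ?nrm_ge0.
exists ([:: a], e / (nrm b + 1)); first by rewrite /= divr_gt0.
move=> S [NS S1 /(_ a (mem_head _ _)) Sa].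
rewrite /= distrC -reNl -reDl; apply: le_lt_trans (re_le _ _) _.
apply: (@le_lt_trans _ _ (e / (nrm b + 1) * nrm b)).
  by rewrite ler_wpM2r ?nrm_ge0.
by rewrite mulrAC ltr_pdivrMr// ltr_pM2l// ltrDl.
Qed.

Lemma weakly_adherentZ (c : R[i]) A :
  weakly_adherent A -> weakly_adherent (c *: A).
Proof.
move=> wA s sN.
rewrite (eq_bigr (fun p => re (A p.1) (c^*%C *: p.2))) => [|p _]; last first.
  by rewrite bopE reZ.
have := wA [seq (p.1, c^*%C *: p.2) | p <- s].
rewrite big_map; apply=> S NS; rewrite big_map.
apply: etrans (sN _ (lin_closedZ c NS)).
by apply: eq_bigr => p _; rewrite bopE reZ.
Qed.

Lemma weakly_adherentD A B :
  weakly_adherent A -> weakly_adherent B -> weakly_adherent (A + B).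
Proof.
move=> wA wB s sN; rewrite (eq_bigr (fun p => re (A p.1) p.2 + re (B p.1) p.2)).
  by rewrite big_split /= wA// wB// addr0.
by move=> p _; rewrite bopE reDl.
Qed.

Lemma weakly_adherent_adjoint A B :
  is_adjoint A B -> weakly_adherent A -> weakly_adherent B.
Proof.
move=> /is_adjointP AB wA s sN.
rewrite (eq_bigr (fun p => re (A p.2) p.1)) => [|p _]; last by rewrite AB reC.
have := wA [seq (p.2, p.1) | p <- s]; rewrite big_map; apply=> S NS.
have [S' NS' /is_adjointP SS'] := N_adj NS.
rewrite big_map; apply: etrans (sN _ NS').
by apply: eq_bigr => p _; rewrite SS' reC.
Qed.

(** Let Z be the transform of A/(n+1) given by the previous lemma. The rescaled
    W = (n+1)/2 Z is in N and differs from A by ZA^2/(2(n+1)), so it tends to A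
    in norm while remaining bounded. *)
Lemma adherent_mem_selfadjoint A : is_adjoint A A -> weakly_adherent A -> N A.
Proof.
move=> sA wA; have /is_adjointP AA := sA.
have [r r0 Ar] := bounded_by_ex A.
pose e n : R := n.+1%:R^-1.
have e0 n : 0 < e n by rewrite invr_gt0.
have e1 n : e n <= 1 by rewrite invf_le1// ler1n.
have /choice[Z ZP] n : exists Z, N Z /\ (bounded_by 1 Z /\
    forall a, Z (a + (e n)%:C *: A ((e n)%:C *: A a)) = 2%:C *: ((e n)%:C *: A a)).
  have [||Z NZ ZA] := @bounded_transform_adherent ((e n)%:C *: A).
  - by apply/is_adjointP => x y; rewrite !bopE reZl reZr AA.
  - exact: weakly_adherentZ.
  by exists Z.
pose W n : bop H := (2^-1 * n.+1%:R)%:C *: Z n.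
have WA n a : W n a - A a = - ((2^-1 * e n)%:C *: Z n (A (A a))).
  have [_ [_ /(_ a)]] := ZP n; rewrite bopD !bopZ !scalerA -!rmorphM /= => ZE.
  rewrite -[X in X - _]/((2^-1 * n.+1%:R)%:C *: Z n a).
  have n1 : n.+1%:R != 0 :> R by rewrite pnatr_eq0.
  rewrite (canRL (addrK _) ZE) scalerBr !scalerA -!rmorphM /= /e.
  have -> : 2^-1 * n.+1%:R * (2 * n.+1%:R^-1) = 1 :> R by field.
  have -> : 2^-1 * n.+1%:R * (n.+1%:R^-1 * n.+1%:R^-1) = 2^-1 / n.+1%:R :> R.
    by field.
  by rewrite scale1r addrAC subrr add0r.
have NW n : N (W n) by apply: lin_closedZ; case: (ZP n).
have W_le n a : nrm (W n a - A a) <= e n * (r ^+ 2 * nrm a).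
  rewrite WA nrmN nrmZ ger0_norm ?mulr_ge0 ?invr_ge0 ?(ltW (e0 n))//.
  have [_ [/(_ (A (A a))) Z1 _]] := ZP n; rewrite mul1r in Z1.
  have AAr : nrm (A (A a)) <= r ^+ 2 * nrm a.
    by rewrite expr2 -mulrA (le_trans (Ar _))// ler_wpM2l ?(ltW r0).
  apply: (@le_trans _ _ (e n * nrm (Z n (A (A a))))).
    by rewrite ler_wpM2r ?nrm_ge0// ler_piMl ?(ltW (e0 n))// invf_le1// ler1n.
  by rewrite ler_wpM2l ?(ltW (e0 n))// (le_trans Z1).
have Wr n : bounded_by (r + r ^+ 2) (W n).
  move=> a; rewrite -[W n a](subrK (A a)); apply: le_trans (nrmD _ _) _.
  rewrite addrC mulrDl lerD ?Ar//; apply: le_trans (W_le n a) _.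
  by rewrite ler_piMl ?mulr_ge0 ?exprn_ge0 ?nrm_ge0 ?(ltW r0).
have rr0 : 0 < r + r ^+ 2 by rewrite ltr_wpDr ?exprn_ge0 ?ltW.
have [B NB [_ WB]] := ball_seq_limit rr0 NW Wr.
suff -> : A = B by [].
apply: bop_eqP => x y; apply/esym/WB; apply/cvgrPdist_lt => d d0.
pose K := r ^+ 2 * nrm x * nrm y.
have K0 : 0 <= K by rewrite !mulr_ge0 ?exprn_ge0 ?nrm_ge0 ?(ltW r0).
have K1 : 0 < K + 1 by rewrite ltr_wpDl.
have /ltr_add_invr[M] := divr_gt0 d0 K1; rewrite add0r => Md.
exists M => // n /= Mn; rewrite distrC -reNl -reDl.
apply: le_lt_trans (re_le _ _) _.
apply: (@le_lt_trans _ _ (e n * K)).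
  by rewrite /K mulrA ler_wpM2r ?nrm_ge0// W_le.
have nM : e n <= e M by rewrite lef_pV2 ?posrE// ler_nat ltnS.
apply: (@le_lt_trans _ _ (e M * (K + 1))); last by rewrite -ltr_pdivlMr.
by rewrite ler_pM ?(ltW (e0 n))// lerDl.
Qed.

(** With B the adjoint of A, the operators A + B and i(A - B) are self-adjoint,
    weakly adherent, and span A. *)
Lemma adherent_mem A : weakly_adherent A -> N A.
Proof.
move=> wA; have [B AB] := adjoint_ex A.
have wB := weakly_adherent_adjoint AB wA.
have /is_adjointP AB1 := AB; have /is_adjointP BA1 := is_adjointC AB.
have iconj : ('i : R[i])^*%C = - 'i%C by rewrite /= /GRing.opp /= oppr0.
have NP : N (A + B).
  apply: adherent_mem_selfadjoint; last exact: weakly_adherentD.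
  by apply/is_adjointP => x y; rewrite !bopE reDl reDr AB1 BA1 addrC.
have NM : N ('i%C *: (A + (-1) *: B)).
  apply: adherent_mem_selfadjoint.
    apply/is_adjointP => x y; rewrite !bopE reZ iconj !scaleN1r.
    rewrite reDl reNl AB1 BA1 -reNr -reDr !bopZ !scaleNr opprK.
    by rewrite scalerBr addrC.
  by apply: weakly_adherentZ; apply: weakly_adherentD => //; exact: weakly_adherentZ.
have -> : A = 2^-1%:C *: ((- 'i%C) *: ('i%C *: (A + (-1) *: B)) + (A + B)).
  rewrite scalerA mulNr -expr2 sqr_i opprK scale1r scaleN1r addrACA addNr addr0.
  have -> : A + A = 2%:C *: A.
    by rewrite (rmorph_nat (real_complex R)) scaler_nat mulr2n.
  by rewrite scalerA -rmorphM /= mulVf// scale1r.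
by apply: lin_closedZ; apply: lin_closedD => //; exact: lin_closedZ.
Qed.

End Kaplansky.

(** * The predual as a source of coordinates *)

Section UltraweakForms.
Context {R : realType} (H : hilbertType R).
Implicit Types (x y z : H) (S T A : bop H).

(** The coefficients <T x, y> are ultraweak forms: take the square-summable
    sequences whose only nonzero term is the first. *)
Lemma single_l2 x :
  cvgn (series (fun n => `|if n is 0 then x else 0| ^+ 2 : R[i]^o)).
Proof.
apply: (cvgP (`|x| ^+ 2 : R[i]^o)); apply: cvg_near_cst.
exists 1%N => // -[//|n] _; rewrite /series /= big_nat_recl// big1 ?addr0//.
by move=> i _; rewrite normr0 expr0n.
Qed.

Definition single x : l2seq H := 
  exist (fun u : nat -> H => cvgn (series (fun n => `|u n| ^+ 2 : R[i]^o)))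
    (fun n => if n is 0 then x else 0) (@single_l2 x).

Lemma ultraweak_form_single T x y :
  ultraweak_form T (single x, single y) = inner (T x) y.
Proof.
rewrite /ultraweak_form /=; apply: lim_near_cst => //.
exists 1%N => // -[//|n] _; rewrite /series /= big_nat_recl// big1 ?addr0//.
by move=> i _; rewrite linear0r.
Qed.

Lemma ultraweak_inner_continuous x y :
  continuous (fun T : ultraweak H => inner ((T : bop H) x) y : R[i]^o).
Proof.
move=> T.
have c : {ptws, ultraweak_form S @[S --> T] --> ultraweak_form T}.
  exact: (@initial_continuous (bop H) {ptws l2seq H * l2seq H -> R[i]^o}
    (@ultraweak_form R H) T).
have := proj1 (@ptws_cvgP _ _ _ (fmap_filter _ (nbhs_filter (T : ultraweak H))) _) c
  (single x, single y).
have E : (fun S : ultraweak H => ultraweak_form S (single x, single y)) =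
    (fun S : ultraweak H => inner ((S : bop H) x) y).
  by apply/funext => S; rewrite ultraweak_form_single.
rewrite ultraweak_form_single -[X in fmap X _]/(fun g => g (single x, single y)).
rewrite /continuous_at -E; exact.
Qed.

Lemma ultraweak_re_continuous x y :
  continuous (fun T : ultraweak H => re ((T : bop H) x) y).
Proof.
move=> T; have FF := nbhs_filter (T : ultraweak H).
by have /cvg_complexP[] := @ultraweak_inner_continuous x y T.
Qed.

(** Finite sums of matrix coefficients are ultraweakly continuous, so their zero
    sets are closed. *)
Lemma closure_weakly_adherent (N : set (bop H)) T :
  closure (N : set (ultraweak H)) T -> weakly_adherent N T.
Proof.
move=> NT s sN.
pose f (S : ultraweak H) := \sum_(p <- s) re ((S : bop H) p.1) p.2.
have fc : continuous f.
  move=> S; have FF := nbhs_filter (S : ultraweak H).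
  rewrite /f; elim: (s) => [|p s' IHs].
    rewrite (_ : (fun S : ultraweak H => \sum_(p <- [::]) _) = fun=> 0).
      exact: cvg_cst.
    by apply/funext => S'; rewrite big_nil.
  rewrite (_ : (fun S : ultraweak H => \sum_(p0 <- p :: s') _) =
      (fun S : ultraweak H =>
         re ((S : bop H) p.1) p.2 + \sum_(p <- s') re ((S : bop H) p.1) p.2)).
    by apply: cvgD; [exact: ultraweak_re_continuous|exact: IHs].
  by apply/funext => S'; rewrite big_cons.
have c0 : closed (f @^-1` [set 0]).
  by apply: closed_comp => [S _|]; [exact: fc|exact: closed_eq].
have := closure_subset (B := f @^-1` [set 0]) (_ : N `<=` _) NT.
move=> /(_ sN)/c0; exact.
Qed.

End UltraweakForms.

Section RealCoordinates.
Context {R : realType} (H : hilbertType R) (M : set (bop H)).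
Hypotheses (cM : closed (M : set (ultraweak H))) (sepM : separable_predual M).

Lemma predual_continuous phi : predual M phi ->
  continuous (fun t : weak_ball M => phi (set_val t) : R[i]^o).
Proof.
move=> [_ /subspace_sigL_continuousP phic].
pose k (t : weak_ball M) : set_type (M : set (ultraweak H)) :=
  exist _ (set_val t) (mem_set (weak_ball_mem t)).
move=> t.
have kc : continuous k.
  by apply: continuous_comp_initial; exact: ultraweak_continuous.
exact: (continuous_comp (@kc t) (phic (k t))).
Qed.

Lemma predual_form x y : predual M (fun T => inner (T x) y).
Proof.
split=> [c S T _ _|]; first by rewrite bopE linearDl linearZl_LR.
exact: continuous_subspaceT (@ultraweak_inner_continuous R H x y).
Qed.

(** The supremum defining [dual_norm] bounds its terms only because it is taken
    over a bounded set, and it is: the functionals are continuous on the compact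
    ball. *)
Lemma le_dual_norm phi psi (t : weak_ball M) :
  predual M phi -> predual M psi ->
  Re `|phi (set_val t) - psi (set_val t)| <= dual_norm M (fun T => phi T - psi T).
Proof.
move=> phiM psiM; apply: ub_le_sup; last by exists (set_val t) => //; exact: set_valP.
pose f (s : weak_ball M) : R[i]^o := phi (set_val s) - psi (set_val s).
have fc : continuous f.
  move=> s; have FF := nbhs_filter s.
  by apply: cvgB; exact: predual_continuous.
have cX := weak_ball_compact cM.
have bound (g : weak_ball M -> R) : continuous g -> exists B, forall s, `|g s| <= B.
  move=> gc; have : compact (g @` [set: weak_ball M]).
    by apply: continuous_compact cX; exact: continuous_subspaceT.
  move=> /(@compact_bounded R R^o)/pinfty_ex_gt0[B _ gB].
  by exists B => s; apply: gB; exists s.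
have [B1 fB1] : exists B, forall s, `|Re (f s)| <= B.
  apply: bound => s; have FF := nbhs_filter s.
  by have /cvg_complexP[] := fc s.
have [B2 fB2] : exists B, forall s, `|Im (f s)| <= B.
  apply: bound => s; have FF := nbhs_filter s.
  by have /cvg_complexP[] := fc s.
exists (B1 + B2) => _ [T MT <-].
have := fB1 (exist _ T (mem_set MT)); have := fB2 (exist _ T (mem_set MT)).
move=> h2 h1; apply: le_trans (lerD h1 h2).
exact: norm_le_ReIm.
Qed.

(** Real and imaginary parts of a dense sequence of normal functionals. Since
    the dual norm is uniform convergence on the ball, points that agree on the
    dense sequence agree on all matrix coefficients. *)
Lemma real_coordinates : exists r : nat * bool -> weak_ball M -> R,
  (forall j, continuous (r j)) /\
  (forall s t, (forall j, r j s = r j t) -> s = t).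
Proof.
have [D [/countable_injP[f finj] DM Ddense]] := sepM.
pose e n := xget (fun=> 0) [set phi | D phi /\ f phi = n].
have eM n : predual M (e n).
  rewrite /e; case: xgetP => [phi _ [/DM//]|_].
  split=> [a S T _ _|]; first by rewrite mulr0 addr0.
  by apply: continuous_subspaceT => T;
    apply: (@cvg_cst _ _ _ _ (nbhs_filter (T : ultraweak H))).
have De phi : D phi -> e (f phi) = phi.
  move=> Dphi; have [] := @xgetPex _ (fun=> 0) [set psi | D psi /\ f psi = f phi].
    by exists phi.
  by move=> De fe; apply: finj; rewrite ?inE.
exists (fun j t => if j.2 then Re (e j.1 (set_val t)) else Im (e j.1 (set_val t))).
split=> [[n b] t|s t st].
  have FF := nbhs_filter t.
  have /cvg_complexP[] := predual_continuous (eM n) (x := t).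
  by case: b.
apply/val_inj/bop_eqP => x y; apply/eqP; rewrite -subr_eq0 -normr_eq0.
rewrite eq_le normr_ge0 andbT; apply/ler_addgt0Pr => d d0; rewrite add0r.
have [psi Dpsi psid] := Ddense _ (predual_form x y) (d / 2) (divr_gt0 d0 (ltr0n _ 2)).
have psi_st : psi (set_val s) = psi (set_val t).
  apply/eqP; rewrite eq_complex -(De _ Dpsi).
  by have /= -> := st (f psi, true); have /= -> := st (f psi, false); rewrite !eqxx.
have close (u : weak_ball M) : `|re (set_val u x) y - Re (psi (set_val u))| <= d / 2.
  apply: le_trans (ltW psid).
  apply: le_trans (le_dual_norm u (predual_form x y) (DM _ Dpsi)).
  by rewrite -ReN -ReD Re_le_norm.
have := close s; have := close t; rewrite psi_st !ler_norml; lra.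
Qed.

End RealCoordinates.

(** * Operations on the unit ball *)

Section BallOperations.
Context {R : realType} (H : hilbertType R) (M : set (bop H)).
Hypothesis M_vN : von_neumann M.
Implicit Types (x y z : H) (S T A : bop H) (s t u : weak_ball M).

Let M1 : M 1. Proof. by case: M_vN. Qed.
Let M_lin : forall c S T, M S -> M T -> M (c *: S + T). Proof. by case: M_vN. Qed.
Let M_mul : forall S T, M S -> M T -> M (S * T). Proof. by case: M_vN. Qed.
Let M_adj : forall T, M T -> exists2 S, M S & is_adjoint T S.
Proof. by case: M_vN. Qed.
Let M_closed : closed (M : set (ultraweak H)). Proof. by case: M_vN. Qed.
Let M_scale c T : M T -> M (c *: T). Proof. exact: lin_closedZ. Qed.
Let M_add S T : M S -> M T -> M (S + T). Proof. exact: lin_closedD. Qed.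

Lemma scale_le1 (c : R[i]) s : Re `|c| <= 1 -> bounded_by 1 (c *: set_val s).
Proof.
move=> c1 x; rewrite bopE nrmZc mul1r.
have := weak_ball_le1 s x; rewrite mul1r; apply: le_trans.
by rewrite ler_piMl ?nrm_ge0.
Qed.

Definition scalar := {c : R[i] | Re `|c| <= 1}.

Definition to_scalar (c : R[i]) (c1 : Re `|c| <= 1) : scalar :=
  exist (fun c : R[i] => Re `|c| <= 1) c c1.

Definition ball_scale (c : scalar) s : weak_ball M :=
  to_ball (M_scale (val c) (weak_ball_mem s)) (scale_le1 s (valP c)).

Lemma midpoint_le1 s t : bounded_by 1 (2^-1%:C *: (set_val s + set_val t)).
Proof.
have := bounded_byZ 2^-1 (bounded_byD (weak_ball_le1 s) (weak_ball_le1 t)).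
by rewrite ger0_norm ?invr_ge0// mulVf.
Qed.

Definition ball_midpoint s t : weak_ball M :=
  to_ball (M_scale 2^-1%:C (M_add (weak_ball_mem s) (weak_ball_mem t)))
    (midpoint_le1 s t).

Lemma mul_le1 s t : bounded_by 1 (set_val s * set_val t).
Proof.
by have := bounded_byM ler01 (weak_ball_le1 s) (weak_ball_le1 t); rewrite mulr1.
Qed.

Definition ball_mul s t : weak_ball M :=
  to_ball (M_mul (weak_ball_mem s) (weak_ball_mem t)) (mul_le1 s t).

Definition ball_one : weak_ball M := to_ball M1 (@bounded_by1 R H).

Lemma ball_adjoint_ex s :
  exists t : weak_ball M, is_adjoint (set_val s) (set_val t).
Proof.
have [S MS sS] := M_adj (weak_ball_mem s).
exists (to_ball MS (adjoint_bounded_by ler01 sS (weak_ball_le1 s))).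
exact: sS.
Qed.

Definition ball_adjoint s : weak_ball M := sval (cid (ball_adjoint_ex s)).

Lemma ball_adjointP s : is_adjoint (set_val s) (set_val (ball_adjoint s)).
Proof. by rewrite /ball_adjoint; case: cid. Qed.

Lemma ball_scale_continuous c : continuous (ball_scale c).
Proof.
apply: continuous_weak_ball => x y.
rewrite (_ : (fun s => _) = fun s => re (set_val s x) ((val c)^*%C *: y)).
  exact: weak_ball_re_continuous.
by apply/funext => s; rewrite bopE reZ.
Qed.

Lemma ball_midpointC s t : ball_midpoint s t = ball_midpoint t s.
Proof. by apply: val_inj; rewrite /= addrC. Qed.

Lemma ball_midpoint_continuousr s : continuous (ball_midpoint s).
Proof.
apply: continuous_weak_ball => x y.
rewrite (_ : (fun t => _) = fun t =>
    2^-1 * (re (set_val s x) y + re (set_val t x) y)).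
  move=> t; have FF := nbhs_filter t; apply: cvgMr.
  by apply: cvgD; [exact: cvg_cst|exact: weak_ball_re_continuous].
by apply/funext => t; rewrite !bopE reZl reDl.
Qed.

Lemma ball_midpoint_continuousl t : continuous (ball_midpoint^~ t).
Proof.
rewrite (_ : ball_midpoint^~ t = ball_midpoint t).
  exact: ball_midpoint_continuousr.
by apply/funext => s; exact: ball_midpointC.
Qed.

(** The adjoint moves the fixed first factor to the other side of the inner
    product. *)
Lemma ball_mul_continuousr s : continuous (ball_mul s).
Proof.
apply: continuous_weak_ball => x y.
rewrite (_ : (fun t => _) = fun t => re (set_val t x) (set_val (ball_adjoint s) y)).
  exact: weak_ball_re_continuous.
apply/funext => t; rewrite bopE.
by have /is_adjointP -> := ball_adjointP s.
Qed.

Lemma ball_mul_continuousl t : continuous (ball_mul^~ t).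
Proof.
apply: continuous_weak_ball => x y.
exact: (@weak_ball_re_continuous R H M (set_val t x) y).
Qed.

Lemma ball_adjoint_continuous : continuous ball_adjoint.
Proof.
apply: continuous_weak_ball => x y.
rewrite (_ : (fun s => _) = fun s => re (set_val s y) x).
  exact: weak_ball_re_continuous.
apply/funext => s; rewrite reC.
by have /is_adjointP <- := ball_adjointP s.
Qed.

Lemma half_le1 : Re `|(2^-1 : R)%:C| <= 1.
Proof.
by rewrite ger0_norm ?ler0c ?invr_ge0//= invf_le1// ler1n.
Qed.

Definition ball_half : weak_ball M -> weak_ball M :=
  ball_scale (to_scalar half_le1).

(** The last condition says that F contains the double of each of its points if
    that double is in the ball of M. *)
Definition subalgebra_ball_set (F : set (weak_ball M)) : Prop :=
  [/\ F !=set0, stable (fun s t u => u = ball_one) F,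
      stable (fun s t u => u = ball_midpoint s t) F &
      [/\ stable (fun s t u => exists c, u = ball_scale c s) F,
          stable (fun s t u => u = ball_mul s t) F,
          stable (fun s t u => u = ball_adjoint s) F &
          stable (fun s t u => s = ball_half u) F]].

Lemma Gdelta_subalgebra_ball_set (I : countType) (f : I -> weak_ball M -> R) :
  cozero_base f ->
  Gdelta [set F : closed_subsets (weak_ball M) | subalgebra_ball_set (set_val F)].
Proof.
move=> fB.
have E : [set F : closed_subsets (weak_ball M) | subalgebra_ball_set (set_val F)] =
  [set F | set_val F `&` setT !=set0] `&`
  ([set F | stable (fun s t u => u = ball_one) (set_val F)] `&`
  ([set F | stable (fun s t u => u = ball_midpoint s t) (set_val F)] `&`
  ([set F | stable (fun s t u => exists c, u = ball_scale c s) (set_val F)] `&`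
  ([set F | stable (fun s t u => u = ball_mul s t) (set_val F)] `&`
  ([set F | stable (fun s t u => u = ball_adjoint s) (set_val F)] `&`
  [set F | stable (fun s t u => s = ball_half u) (set_val F)]))))).
  apply/seteqP; split=> F /=; rewrite setIT.
    by move=> [? ? ? []].
  by move=> [? [? [? [? [? []]]]]].
rewrite E; do ?apply: GdeltaI; last first.
- apply: (Gdelta_stable fB); apply: sigma_rectangular_inv => //.
  + exact: weak_ball_compact.
  + exact: weak_ball_hausdorff.
  + exact: ball_scale_continuous.
- apply: (Gdelta_stable fB); apply: sigma_rectangular_op => // [_|s].
    exact: ball_adjoint_continuous.
  exact: cst_continuous.
- apply: (Gdelta_stable fB); apply: sigma_rectangular_op => //.
    exact: ball_mul_continuousl.
  exact: ball_mul_continuousr.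
- apply: (Gdelta_stable fB); apply: sigma_rectangular_family => //.
  exact: ball_scale_continuous.
- apply: (Gdelta_stable fB); apply: sigma_rectangular_op => //.
    exact: ball_midpoint_continuousl.
  exact: ball_midpoint_continuousr.
- apply: (Gdelta_stable fB).
  by apply: (sigma_rectangular_op fB) => ?; exact: cst_continuous.
- by apply: open_Gdelta; apply: open_hit; exact: openT.
Qed.

End BallOperations.

(** * The balls of von Neumann subalgebras *)

Section SubalgebraBalls.
Context {R : realType} (H : hilbertType R) (M : set (bop H)).
Hypothesis M_vN : von_neumann M.
Implicit Types (x y z : H) (S T A : bop H) (s t u : weak_ball M).

Lemma ball_inE (N : set (bop H)) t : ball_in N t <-> N (set_val t).
Proof.
split=> [[]//|Nt]; split=> //.
by apply/opnorm_bounded_by; exact: weak_ball_le1.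
Qed.

Lemma subalgebra_ball_stable (N : subalgebras M) :
  subalgebra_ball_set M_vN (set_val (subalgebra_ball N)).
Proof.
have [N_vN NM] := set_valP N; have [N1 N_lin N_mul N_adj _] := N_vN.
have memN t : set_val (subalgebra_ball N) t <-> set_val N (set_val t).
  exact: ball_inE.
split.
- by exists (ball_one M_vN); apply/memN.
- by move=> s t u _ _ ->; apply/memN.
- move=> s t u /memN Ns /memN Nt ->; apply/memN.
  by apply: (lin_closedZ N1 N_lin); exact: (lin_closedD N_lin).
split.
- by move=> s _ u /memN Ns _ [c ->]; apply/memN; exact: (lin_closedZ N1 N_lin).
- by move=> s t u /memN Ns /memN Nt ->; apply/memN; exact: N_mul.
- move=> s _ u /memN Ns _ ->; apply/memN.
  have [T NT sT] := N_adj _ Ns.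
  by rewrite (is_adjoint_uniq (ball_adjointP M_vN s) sT).
- move=> s _ u /memN Ns _ su; apply/memN.
  have -> : set_val u = 2%:C *: set_val s.
    by rewrite su /= scalerA -rmorphM mulfV// scale1r.
  exact: (lin_closedZ N1 N_lin).
Qed.

Variable F : set (weak_ball M).
Hypotheses (cF : closed F) (stF : subalgebra_ball_set M_vN F).

(** Powers of 2 suffice as factors, and they let membership be tested by
    iterating the doubling condition ([dilated_mem]). *)
Definition dilated T : Prop :=
  exists n : nat, exists2 s, F s & T = (2 ^+ n)%:C *: set_val s.

Let F_one : F (ball_one M_vN).
Proof. by case: stF => -[s Fs] F1 _ _; exact: (F1 _ _ _ Fs Fs). Qed.
Let F_mid s t : F s -> F t -> F (ball_midpoint M_vN s t).
Proof. by case: stF => _ _ Fm _ Fs Ft; exact: (Fm _ _ _ Fs Ft). Qed.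
Let F_scale c s : F s -> F (ball_scale M_vN c s).
Proof. by case: stF => _ _ _ [Fc _ _ _] Fs; apply: (Fc s s) => //; exists c. Qed.
Let F_mul s t : F s -> F t -> F (ball_mul M_vN s t).
Proof. by case: stF => _ _ _ [_ Fm _ _] Fs Ft; exact: (Fm _ _ _ Fs Ft). Qed.
Let F_adj s : F s -> F (ball_adjoint M_vN s).
Proof. by case: stF => _ _ _ [_ _ Fa _] Fs; exact: (Fa _ _ _ Fs Fs). Qed.
Let F_double u : F (ball_half M_vN u) -> F u.
Proof. by case: stF => _ _ _ [_ _ _ Fh] Fu; exact: (Fh _ _ _ Fu Fu). Qed.

Lemma dilated_mem u : dilated (set_val u) -> F u.
Proof.
move=> [n]; elim: n u => [|n IHn] u [s Fs uE].
  suff -> : u = s by [].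
  by apply: val_inj; rewrite [LHS]uE expr0 scale1r.
apply: F_double; apply: IHn; exists s => //.
have -> : set_val (ball_half M_vN u) = 2^-1%:C *: set_val u by [].
by rewrite uE scalerA -rmorphM exprS mulrA mulVf// mul1r.
Qed.

Lemma mem_dilated s : F s -> dilated (set_val s).
Proof. by move=> Fs; exists 0%N, s => //; rewrite expr0 scale1r. Qed.

Lemma dilated_sub : dilated `<=` M.
Proof.
move=> _ [n [s _ ->]]; case: M_vN => M1 M_lin _ _ _.
by apply: (lin_closedZ M1 M_lin); exact: weak_ball_mem.
Qed.

Lemma dilated_scale c T : dilated T -> dilated (c *: T).
Proof.
move=> [n [s Fs ->]].
have [k ck] : exists k : nat, Re `|c| <= 2 ^+ k.
  exists (Num.truncn (Re `|c|)).+1.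
  have := truncnS_gt (Re `|c|) => /ltW/le_trans; apply.
  by rewrite -natrX ler_nat ltnW// ltn_expl.
have k0 : 0 < 2 ^+ k :> R by rewrite exprn_gt0.
have d1 : Re `|c / (2 ^+ k)%:C| <= 1.
  rewrite normrM normfV [X in _ * X^-1]ger0_norm; last by rewrite ler0c ltW.
  rewrite -fmorphV mulrC -(RRe_real (normr_real c)) -rmorphM /=.
  by rewrite mulrC ler_pdivrMr// mul1r.
exists (k + n)%N, (ball_scale M_vN (to_scalar d1) s); first exact: F_scale.
rewrite /= !scalerA; congr (_ *: _).
rewrite -[\val _]/(c / (2 ^+ k)%:C) exprD rmorphM [RHS]mulrC mulrA divfK//.
by rewrite (inj_eq (@complexI R)) gt_eqF.
Qed.

Lemma shrink (n : nat) s : F s ->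
  exists2 s', F s' & set_val s = (2 ^+ n)%:C *: set_val s'.
Proof.
move=> Fs; elim: n => [|n [s' Fs' ->]]; first by exists s; rewrite // scale1r.
exists (ball_half M_vN s'); first exact: F_scale.
have -> : set_val (ball_half M_vN s') = 2^-1%:C *: set_val s' by [].
by rewrite scalerA -rmorphM exprSr mulfK.
Qed.

Lemma dilated_add S T : dilated S -> dilated T -> dilated (S + T).
Proof.
move=> [n [s Fs ->]] [m [t Ft ->]].
have [s' Fs' ->] := shrink m Fs; have [t' Ft' ->] := shrink n Ft.
exists (n + m).+1, (ball_midpoint M_vN s' t'); first exact: F_mid.
have -> : set_val (ball_midpoint M_vN s' t') =
  2^-1%:C *: (set_val s' + set_val t') by [].
rewrite !scalerA -!rmorphM -!exprD exprSr mulfK// [(m + n)%N]addnC.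
by rewrite -scalerDr.
Qed.

(** Only the closure needs an argument: the unit ball of the dilated set is F,
    which is compact, so that [adherent_mem] applies. *)
Lemma dilated_von_neumann : von_neumann dilated.
Proof.
have [M1 M_lin M_mul M_adj M_closed] := M_vN.
have d1 : dilated 1 by apply: (mem_dilated F_one).
have d_lin c S T : dilated S -> dilated T -> dilated (c *: S + T).
  by move=> dS dT; apply: dilated_add => //; exact: dilated_scale.
have d_mul S T : dilated S -> dilated T -> dilated (S * T).
  move=> [n [s Fs ->]] [m [t Ft ->]].
  exists (n + m)%N, (ball_mul M_vN s t); first exact: F_mul.
  apply: bop_eqP => x y; congr (re _ y).
  by rewrite !bopE bopZ scalerA -rmorphM -exprD.
have d_adj T : dilated T -> exists2 S, dilated S & is_adjoint T S.
  move=> [n [s Fs ->]]; have /is_adjointP sS := ball_adjointP M_vN s.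
  exists ((2 ^+ n)%:C *: set_val (ball_adjoint M_vN s)).
    by exists n, (ball_adjoint M_vN s) => //; exact: F_adj.
  by apply/is_adjointP => x y; rewrite !bopE reZl reZr sS.
split=> // T dT.
apply: (adherent_mem d1 d_lin d_mul d_adj); last exact: closure_weakly_adherent.
move=> G GU GN.
(* The ultrafilter lives on all operators; j retracts them onto the ball of
   M, with an arbitrary value outside it. *)
pose j S : weak_ball M := if pselect (M S /\ bounded_by 1 S) is left MS
  then to_ball MS.1 MS.2 else ball_one M_vN.
have jE S : M S -> bounded_by 1 S -> set_val (j S) = S.
  by move=> MS S1; rewrite /j; case: pselect => // -[].
have GM : G [set S | dilated S /\ set_val (j S) = S].
  apply: filterS GN => S [dS S1]; split=> //.
  by apply: jE => //; exact: dilated_sub.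
have := weak_ball_compact M_closed; rewrite compact_ultra.
move=> /(_ (j @ G) (ultra_fmap j GU) filterT)[t [_ jt]].
have Ft : F t.
  apply: (closed_cvg (F := G) (u_ := j) _ cF _ _ jt).
  by apply: filterS GM => S [dS jS]; apply: dilated_mem; rewrite jS.
exists (set_val t); split; [exact: mem_dilated|exact: weak_ball_le1|].
move=> x y; have /(_ _ x y) := proj1 (weak_ball_cvgP (F := j @ G) _ _) jt.
apply: cvg_trans; apply: near_eq_cvg.
by apply: filterS GM => S [_ /= ->].
Qed.

Lemma dilated_ball : ball_in dilated = F.
Proof.
apply/seteqP; split=> s; first by move/ball_inE; exact: dilated_mem.
by move=> Fs; apply/ball_inE; exact: mem_dilated.
Qed.

End SubalgebraBalls.

Section Marechal.
Context {R : realType} (H : hilbertType R) (M : set (bop H)).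
Hypothesis M_vN : von_neumann M.

Lemma range_subalgebra_ball : range (@subalgebra_ball R H M) =
  [set F : closed_subsets (weak_ball M) | subalgebra_ball_set M_vN (set_val F)].
Proof.
apply/seteqP; split=> [_ [N _ <-]|F stF]; first exact: subalgebra_ball_stable.
have cF : closed (set_val F) by exact: set_valP.
exists (exist _ (dilated (set_val F))
  (mem_set (conj (dilated_von_neumann cF stF)
    (dilated_sub M_vN (F := set_val F))))) => //.
by apply: val_inj; exact: dilated_ball.
Qed.

(** Every element of an algebra is a multiple of an element of its unit ball. *)
Lemma subalgebra_ball_inj : injective (@subalgebra_ball R H M).
Proof.
have sub (N N' : subalgebras M) : subalgebra_ball N = subalgebra_ball N' ->
    set_val N `<=` set_val N'.
  move=> NN' T NT; have [[N1 N_lin _ _ _] NM] := set_valP N.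
  have [[N1' N_lin' _ _ _] _] := set_valP N'.
  have [r r0 Tr] := bounded_by_ex T.
  have rT : bounded_by 1 (r^-1%:C *: T).
    have := bounded_byZ r^-1 Tr.
    by rewrite ger0_norm ?invr_ge0 ?(ltW r0)// mulVf// gt_eqF.
  have NrT : set_val N (r^-1%:C *: T) by exact: (lin_closedZ N1 N_lin).
  have : set_val (subalgebra_ball N) (to_ball (NM _ NrT) rT) by apply/ball_inE.
  rewrite NN' => /ball_inE /= /(lin_closedZ N1' N_lin' r%:C).
  by rewrite scalerA -rmorphM mulfV ?gt_eqF// scale1r.
by move=> N N' NN'; apply: val_inj; apply/seteqP; split; apply: sub.
Qed.

End Marechal.

Theorem theorem1 (R : realType) (H : hilbertType R) (M : set (bop H))
    (M_vN : von_neumann M) (M_sep : separable_predual M) :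
  polish R (marechal M).
Proof.
have [_ _ _ _ cM] := M_vN; have cX := weak_ball_compact cM.
have [r [rc rsep]] := real_coordinates cM M_sep.
have fB := bump_cozero_base cX rc rsep.
apply: Gdelta_polish (height_coordinates cX fB) (@subalgebra_ball_inj R H M) _.
rewrite (range_subalgebra_ball M_vN).
exact: Gdelta_subalgebra_ball_set fB.
Qed.
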